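(* Let $\sigma \colon I \times \mathbb{R}^{m-1} \to \mathbb{R}^{m+n}$ be a rank-one ruled submanifold. Then there is an open dense subset $W \subset I \times \mathbb{R}^{m-1}$ such that every point of $W$ has an open neighborhood $V \subset W$ on which $\sigma|_{V}$ is, after a diffeomorphic change of parameters, the restriction to an open set of a cylindrical submanifold, of a conical submanifold, or of a tangent submanifold of some regular $(m-1)$-dimensional submanifold. In this sense, an open and dense subset of every rank-one submanifold is a union of cylindrical, conical and tangent submanifolds.
   Context: A (parametrized) submanifold of $\mathbb{R}^{m+n}$ is a smooth map $V \to \mathbb{R}^{m+n}$ with $V \subset \mathbb{R}^{m}$. A point of $V$ is regular if the differential there is injective and singular otherwise; the submanifold is regular if all of its points are regular and singular otherwise. Ruled submanifold: given an open interval $I$, a smooth unit-speed curve $\gamma \colon I \to \mathbb{R}^{m+n}$ and smooth vector fields $X_{1}, \dotsc, X_{m-1}$ along $\gamma$ that are orthonormal at each $t$, the map $\sigma(t,u^{1},\dotsc,u^{m-1}) = \gamma(t) + \sum_{j=1}^{m-1} u^{j} X_{j}(t)$ on $I \times \mathbb{R}^{m-1}$ is a ruled submanifold. At a regular point, $\sigma$ is locally an immersed $m$-dimensional submanifold with second fundamental form $\mathit{II}$. The relative nullity index at a regular point is $\dim \ker \mathit{II}$ there. A ruled submanifold is rank-one if its relative nullity index equals $m-1$ at every regular point. Cylinder: given a smooth unit-speed curve $\gamma \colon I \to \mathbb{R}^{m+n}$ and constant orthonormal vectors $X_{1},\dotsc,X_{m-1}$, the map $(t,u) \mapsto \gamma(t)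 + \sum_{j} u^{j}X_{j}$ on $I \times \mathbb{R}^{m-1}$. Cone: given $U \subset \mathbb{R}^{m-1}$ and a smooth map $\psi \colon U \to \mathbb{R}^{m+n}$ whose differential has rank $m-2$ everywhere, together with a smooth unit vector field $X_{\psi}$ along $\psi$ with $X_{\psi} \notin \operatorname{Span}(\partial\psi/\partial u^{1},\dotsc,\partial\psi/\partial u^{m-1})$ at every point, the map $(u^{1},\dotsc,u^{m}) \mapsto \psi(u^{1},\dotsc,u^{m-1}) + u^{m}X_{\psi}(u^{1},\dotsc,u^{m-1})$ on $U \times \mathbb{R}$. Tangent submanifold: given a regular $(m-1)$-dimensional submanifold $\xi \colon U \to \mathbb{R}^{m+n}$ with $U \subset \mathbb{R}^{m-1}$, together with a smooth unit vector field $X_{\xi}$ along $\xi$ with $\partial\xi/\partial u^{1} \wedge \dotsb \wedge \partial \xi/\partial u^{m-1} \wedge X_{\xi} = 0$ everywhere, the map $(u^{1},\dotsc,u^{m}) \mapsto \xi(u^{1},\dotsc,u^{m-1}) + u^{m}X_{\xi}(u^{1},\dotsc,u^{m-1})$ on $U \times \mathbb{R}$. *)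

(* Defs.v *)
From HB Require Import structures.
From mathcomp Require Import all_boot all_order all_algebra.
From mathcomp Require Import all_classical all_reals all_analysis.
Set Implicit Arguments. Unset Strict Implicit. Unset Printing Implicit Defensive.
Import Order.TTheory GRing.Theory Num.Theory.
Import numFieldNormedType.Exports.
Local Open Scope classical_set_scope.
Local Open Scope ring_scope.

Section Defs.
Variable R : realType.

Fixpoint iterD (V W : normedModType R) (vs : seq V) (f : V -> W) : V -> W :=
  if vs is v :: vs' then fun x => derive (iterD vs' f) x v else f.

Definition smooth_on (V W : normedModType R) (U : set V) (f : V -> W) : Prop :=
  forall (vs : seq V) (x : V), U x ->
    {for x, continuous (iterD vs f)} /\ (forall v, derivable (iterD vs f) x v).

Definition dotv (N : nat) (u v : 'rV[R]_N) : R := (u *m v^T) 0 0.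

Definition ev (p : nat) (i : 'I_p) : 'rV[R]_p := delta_mx 0 i.

Definition jac (p N : nat) (f : 'rV[R]_p -> 'rV[R]_N) (x : 'rV[R]_p) : 'M[R]_(p, N) :=
  \matrix_(i < p) derive f x (ev i).

Definition hess (p N : nat) (f : 'rV[R]_p -> 'rV[R]_N) (j : 'I_p) (x : 'rV[R]_p)
  : 'M[R]_(p, N) :=
  \matrix_(i < p) derive (fun y => derive f y (ev j)) x (ev i).

Definition regular_at (p N : nat) (f : 'rV[R]_p -> 'rV[R]_N) (x : 'rV[R]_p) : bool :=
  row_free (jac f x).

(* Kernel of the second fundamental form at a regular point, pulled back by the
   (injective) differential: the a in R^p such that for every b the normal
   component of d^2 f(a,b) vanishes, i.e. a *m hess f j x lies in the tangent
   space (row space of jac f x) for every j. *)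
Definition nullity_space (p N : nat) (f : 'rV[R]_p -> 'rV[R]_N) (x : 'rV[R]_p)
  : 'M[R]_p :=
  (\bigcap_(j < p) kermx (hess f j x *m cokermx (jac f x)))%MS.

Definition relative_nullity (p N : nat) (f : 'rV[R]_p -> 'rV[R]_N) (x : 'rV[R]_p)
  : nat := \rank (nullity_space f x).

Definition tcoord (k : nat) (x : 'rV[R]_k.+1) : R := x 0 ord0.
Definition ucoord (k : nat) (x : 'rV[R]_k.+1) (j : 'I_k) : R := x 0 (lift ord0 j).
Definition initc (k : nat) (x : 'rV[R]_k.+1) : 'rV[R]_k :=
  \row_(j < k) x 0 (widen_ord (leqnSn k) j).
Definition lastc (k : nat) (x : 'rV[R]_k.+1) : R := x 0 ord_max.

Definition open_interval (I : set R) : Prop := open I /\ is_interval I.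

Definition unit_speed_curve (N : nat) (I : set R) (g : R -> 'rV[R]_N) : Prop :=
  open_interval I /\ smooth_on I g /\
  (forall t, I t -> dotv (derive g t 1) (derive g t 1) = 1).

Definition ruled_map (k N : nat) (g : R -> 'rV[R]_N) (X : 'I_k -> R -> 'rV[R]_N)
  : 'rV[R]_k.+1 -> 'rV[R]_N :=
  fun x => g (tcoord x) + \sum_(j < k) ucoord x j *: X j (tcoord x).

Definition ruled_domain (k : nat) (I : set R) : set 'rV[R]_k.+1 :=
  [set x | I (tcoord x)].
Arguments ruled_domain k I _ : clear implicits.

Definition ruled_data (k N : nat) (I : set R) (g : R -> 'rV[R]_N)
  (X : 'I_k -> R -> 'rV[R]_N) : Prop :=
  unit_speed_curve I g /\ (forall j, smooth_on I (X j)) /\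
  (forall t, I t -> forall i j, dotv (X i t) (X j t) = (i == j)%:R).

Definition rank_one (k N : nat) (D : set 'rV[R]_k.+1) (f : 'rV[R]_k.+1 -> 'rV[R]_N)
  : Prop :=
  forall x, D x -> regular_at f x -> relative_nullity f x = k.

Definition diffeo (p : nat) (V V' : set 'rV[R]_p) (phi : 'rV[R]_p -> 'rV[R]_p) : Prop :=
  open V /\ open V' /\ smooth_on V phi /\
  exists psi : 'rV[R]_p -> 'rV[R]_p, smooth_on V' psi /\
    (forall x, V x -> V' (phi x) /\ psi (phi x) = x) /\
    (forall y, V' y -> V (psi y) /\ phi (psi y) = y).

Definition cylinder_model (k N : nat) (V' : set 'rV[R]_k.+1)
  (F : 'rV[R]_k.+1 -> 'rV[R]_N) : Prop :=
  exists (J : set R) (g : R -> 'rV[R]_N) (X : 'I_k -> 'rV[R]_N),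
    unit_speed_curve J g /\ (forall i j, dotv (X i) (X j) = (i == j)%:R) /\
    V' `<=` ruled_domain k J /\
    F = ruled_map g (fun j _ => X j).

Definition cone_map (k N : nat) (psi X : 'rV[R]_k -> 'rV[R]_N)
  : 'rV[R]_k.+1 -> 'rV[R]_N :=
  fun x => psi (initc x) + lastc x *: X (initc x).

Definition cone_model (k N : nat) (V' : set 'rV[R]_k.+1)
  (F : 'rV[R]_k.+1 -> 'rV[R]_N) : Prop :=
  exists (U : set 'rV[R]_k) (psi X : 'rV[R]_k -> 'rV[R]_N),
    open U /\ smooth_on U psi /\ smooth_on U X /\
    (forall u, U u -> \rank (jac psi u) = k.-1) /\
    (forall u, U u -> dotv (X u) (X u) = 1) /\
    (forall u, U u -> ~~ (X u <= jac psi u)%MS) /\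
    V' `<=` [set x | U (initc x)] /\
    F = cone_map psi X.

(* tangent: xi regular, X unit smooth with
   d xi/du^1 /\ ... /\ d xi/du^(m-1) /\ X = 0, i.e. these m vectors are
   linearly dependent *)
Definition tangent_model (k N : nat) (V' : set 'rV[R]_k.+1)
  (F : 'rV[R]_k.+1 -> 'rV[R]_N) : Prop :=
  exists (U : set 'rV[R]_k) (xi X : 'rV[R]_k -> 'rV[R]_N),
    open U /\ smooth_on U xi /\ smooth_on U X /\
    (forall u, U u -> regular_at xi u) /\
    (forall u, U u -> dotv (X u) (X u) = 1) /\
    (forall u, U u -> ~~ row_free (col_mx (jac xi u) (X u))) /\
    V' `<=` [set x | U (initc x)] /\
    F = cone_map xi X.

End Defs.
Arguments ruled_domain {R} k I _.

(* Main.v *)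
Require Import Defs.
From HB Require Import structures.
From mathcomp Require Import fingroup perm.
From mathcomp Require Import all_boot all_order all_algebra.
From mathcomp Require Import all_classical all_reals all_analysis.
Import Order.TTheory GRing.Theory Num.Theory.
Import numFieldNormedType.Exports.
Local Open Scope classical_set_scope.
Local Open Scope ring_scope.

Set Implicit Arguments.
Unset Strict Implicit.

(* Write P for the projection off the ruling spanned by the X_j.  If some P X_j' is
   nonzero at t, then at a regular point over t the rank-one condition forces the
   kernel of the second fundamental form to be the ruling, so each P X_j' is a
   multiple of the normal part of the t-derivative; hence P g' and all P X_j' lie on
   one line.  So near a generic t either all P X_j' vanish, the ruling is a fixed
   subspace and the map is a cylinder over g itself; or, after permuting the X_j,
   P X_max' is nonzero and the singular points form the graph
   u_max = striction(t, u_1, ..., u_(max-1)).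
   The ruled map is then this singular locus plus multiples of X_max.  Where the
   locus is immersed its tangent space is the ruling, which contains X_max (tangent
   submanifold); where it has corank one on an open set, X_max is transverse to it
   (cone). *)

(** * Calculus of smooth maps *)

Section SmoothCalculus.
Variable R : realType.

(** [iterD] adds each further derivative on the outside. Here the first derivative is split off on
    the inside instead, so that the rule for one derivative of a product or an inverse feeds an
    induction on the order [n]. *)
Fixpoint Cn (V W : normedModType R) (n : nat) (U : set V) (f : V -> W) : Prop :=
  (forall x, U x -> {for x, continuous f} /\ forall v, derivable f x v) /\
  (if n is n'.+1 then forall v, Cn n' U (fun x => derive f x v) else True).

Lemma iterD_rcons (V W : normedModType R) (vs : seq V) (v : V) (f : V -> W) :
  Defs.iterD (rcons vs v) f = Defs.iterD vs (fun x => derive f x v).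
Proof. by elim: vs => //= w vs ->. Qed.

Lemma smooth_onP (V W : normedModType R) (U : set V) (f : V -> W) :
  smooth_on U f <-> forall n, Cn n U f.
Proof.
split=> [sf n|].
  elim: n f sf => [|n IH] f sf; (split; first by move=> x; exact: (sf [::])) => //.
  by move=> v; apply: IH => vs x Ux; rewrite -iterD_rcons; exact: sf.
move=> Cf vs; elim/last_ind: vs f Cf => [|vs v IH] f Cf x Ux.
  exact: (Cf 0%N).1.
by rewrite iterD_rcons; apply: IH => // n; exact: (Cf n.+1).2.
Qed.

Lemma Cn0 (V W : normedModType R) n (U : set V) (f : V -> W) :
  Cn n U f -> forall x, U x -> {for x, continuous f} /\ forall v, derivable f x v.
Proof. by case: n => [|n] []. Qed.

Lemma CnS (V W : normedModType R) n (U : set V) (f : V -> W) : Cn n.+1 U f -> Cn n U f.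
Proof.
by elim: n f => [|n IH] f; [case|case=> Cf Df; split=> // v; exact/IH/Df].
Qed.

(** Derivatives see only germs, and on an open [U] agreement on [U] is agreement near each of its
    points. *)
Lemma Cn_ext (V W : normedModType R) n (U : set V) (f g : V -> W) :
  open U -> (forall x, U x -> f x = g x) -> Cn n U f -> Cn n U g.
Proof.
move=> oU; elim: n f g => [|n IH] f g fg Cf; (split; first last) => //;
  try by move=> v; apply: IH (Cf.2 v) => x Ux; apply: near_eq_derive; near=> y;
    apply: fg; near: y; exact: open_nbhs_nbhs.
all: move=> x Ux; have fgn : {near x, f =1 g}
  by near=> y; apply: fg; near: y; exact: open_nbhs_nbhs.
all: have [cf df] := Cn0 Cf Ux.
all: split=> [|v]; [|exact: near_eq_derivable (df v)].
all: suff : g @ x --> g x by [].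
all: by rewrite -(fg _ Ux); apply: cvg_trans cf; apply: near_eq_cvg; apply: filterS fgn => y ->.
Unshelve. all: by end_near. Qed.

Lemma Cn_cst (V W : normedModType R) n (U : set V) (c : W) : Cn n U (fun _ : V => c).
Proof.
elim: n c => [|n IH] c; (split; first by
  move=> x _; split=> [|v]; [exact: cst_continuous|exact: derivable_cst]) => //.
move=> v; rewrite [X in Cn _ _ X](_ : _ = fun=> 0); first exact: IH.
by apply/funext => x; exact: derive_cst.
Qed.

Lemma Cn_add (V W : normedModType R) n (U : set V) (f g : V -> W) :
  open U -> Cn n U f -> Cn n U g -> Cn n U (fun x => f x + g x).
Proof.
move=> oU; elim: n f g => [|n IH] f g Cf Cg; (split; first by
  move=> x Ux; have [cf df] := Cn0 Cf Ux; have [cg dg] := Cn0 Cg Ux;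
  split=> [|v]; [exact: cvgD|exact: (derivableD (df v) (dg v))]) => //.
move=> v; apply: Cn_ext (IH _ _ (Cf.2 v) (Cg.2 v)) => // x Ux.
by symmetry; apply: deriveD; [exact: (Cn0 Cf Ux).2|exact: (Cn0 Cg Ux).2].
Qed.

Lemma Cn_mul (V : normedModType R) n (U : set V) (f g : V -> R) :
  open U -> Cn n U f -> Cn n U g -> Cn n U (fun x => f x * g x).
Proof.
move=> oU; elim: n f g => [|n IH] f g Cf Cg; (split; first by
  move=> x Ux; have [cf df] := Cn0 Cf Ux; have [cg dg] := Cn0 Cg Ux;
  split=> [|v]; [exact: cvgM|exact: (derivableM (df v) (dg v))]) => //.
move=> v; have C1 := IH _ _ (CnS Cf) (Cg.2 v).
have C2 := IH _ _ (CnS Cg) (Cf.2 v).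
apply: Cn_ext (Cn_add oU C1 C2) => // x Ux.
by symmetry; apply: deriveM; [exact: (Cn0 Cf Ux).2|exact: (Cn0 Cg Ux).2].
Qed.

(** The derivative is [- f^-1 * f^-1] times the derivative of [f]. At order [n] the factor [f^-1] is
    covered by the induction hypothesis, and the product rule does the rest. *)
Lemma Cn_inv (V : normedModType R) n (U : set V) (f : V -> R) :
  open U -> (forall x, U x -> f x != 0) -> Cn n U f -> Cn n U (fun x => (f x)^-1).
Proof.
move=> oU f0; elim: n f f0 => [|n IH] f f0 Cf; (split; first by
  move=> x Ux; have [cf df] := Cn0 Cf Ux; 
  split=> [|v]; [exact: (cvgV (f0 _ Ux) cf)|exact: (derivableV (f0 _ Ux) (df v))]) => //.
move=> v; have Ci := IH _ f0 (CnS Cf).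
have C1 := Cn_mul oU (Cn_mul oU (Cn_cst n U (-1 : R)) (Cn_mul oU Ci Ci)) (Cf.2 v).
apply: Cn_ext C1 => //.
move=> x Ux; rewrite deriveV ?f0//; last exact: (Cn0 Cf Ux).2.
by rewrite mulN1r expr2 invfM.
Qed.

Section Smooth.
Variables (V : normedModType R) (U : set V).
Hypothesis oU : open U.

Lemma smooth_ext (W : normedModType R) (f g : V -> W) :
  (forall x, U x -> f x = g x) -> smooth_on U f -> smooth_on U g.
Proof.
move=> fg /smooth_onP sf; apply/smooth_onP => n; exact: Cn_ext fg (sf n).
Qed.

Lemma smooth_cst (W : normedModType R) (c : W) : smooth_on U (fun _ : V => c).
Proof. by apply/smooth_onP => n; exact: Cn_cst. Qed.

Lemma smooth_add (W : normedModType R) (f g : V -> W) :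
  smooth_on U f -> smooth_on U g -> smooth_on U (fun x => f x + g x).
Proof.
move=> /smooth_onP sf /smooth_onP sg; apply/smooth_onP => n; exact: Cn_add.
Qed.

Lemma smooth_sum (W : normedModType R) (I : Type) (r : seq I) (P : pred I)
    (f : I -> V -> W) :
  (forall i, P i -> smooth_on U (f i)) ->
  smooth_on U (fun x => \sum_(i <- r | P i) f i x).
Proof.
move=> sf; elim: r => [|i r IH].
  by apply: smooth_ext (smooth_cst 0) => x _; rewrite big_nil.
case Pi : (P i); last by apply: smooth_ext IH => x _; rewrite big_cons Pi.
apply: smooth_ext (smooth_add (sf _ Pi) IH) => x _.
by rewrite big_cons Pi.
Qed.

Lemma smooth_mul (f g : V -> R) :
  smooth_on U f -> smooth_on U g -> smooth_on U (fun x => f x * g x).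
Proof.
move=> /smooth_onP sf /smooth_onP sg; apply/smooth_onP => n; exact: Cn_mul.
Qed.

Lemma smooth_opp (f : V -> R) : smooth_on U f -> smooth_on U (fun x => - f x).
Proof.
move=> sf; apply: smooth_ext (smooth_mul (smooth_cst (-1 : R)) sf) => x _.
exact: mulN1r.
Qed.

Lemma smooth_inv (f : V -> R) : (forall x, U x -> f x != 0) ->
  smooth_on U f -> smooth_on U (fun x => (f x)^-1).
Proof.
move=> f0 /smooth_onP sf; apply/smooth_onP => n; exact: Cn_inv.
Qed.

Lemma smooth_derive (W : normedModType R) (f : V -> W) (v : V) :
  smooth_on U f -> smooth_on U (fun x => derive f x v).
Proof.
by move=> /smooth_onP sf; apply/smooth_onP => n; exact: (sf n.+1).2.
Qed.

Lemma smooth_continuous (W : normedModType R) (f : V -> W) x :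
  smooth_on U f -> U x -> {for x, continuous f}.
Proof. by move=> sf Ux; exact: (sf [::] x Ux).1. Qed.

Lemma smooth_derivable (W : normedModType R) (f : V -> W) x v :
  smooth_on U f -> U x -> derivable f x v.
Proof. by move=> sf Ux; exact: (sf [::] x Ux).2. Qed.

Lemma continuous_rV N (f : V -> 'rV[R]_N) x :
  (forall j, {for x, continuous (fun y => f y 0 j)}) -> {for x, continuous f}.
Proof.
move=> cf A [P fP PA]; apply: (@filterS _ _ _ [set y | forall j, P 0 j (f y 0 j)]).
  by move=> y Py; apply: PA => i j; rewrite ord1.
by apply: filter_forall => j; exact/cf/fP.
Qed.

Lemma derive_coord N (f : V -> 'rV[R]_N) x v j :
  derivable f x v -> derive f x v 0 j = derive (fun y => f y 0 j) x v.
Proof. by move=> df; rewrite derive_mx // mxE. Qed.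

(** This reduces vector-valued maps to scalar ones, for which the product and inverse rules were
    proved. *)
Lemma Cn_coord N n (f : V -> 'rV[R]_N) :
  Cn n U f <-> forall j, Cn n U (fun x => f x 0 j).
Proof.
elim: n f => [|n IH] f; split=> Cf.
- move=> j; split=> // x Ux; have [cf df] := Cn0 Cf Ux; split=> [|v].
    exact: (continuous_comp cf (@coord_continuous _ _ _ 0 j _)).
  by move/derivable_mxP: (df v); exact.
- split=> // x Ux; split=> [|v].
    by apply: continuous_rV => j; exact: (Cn0 (Cf j) Ux).1.
  by apply/derivable_mxP => i j; rewrite ord1; exact: (Cn0 (Cf j) Ux).2.
- move=> j; split=> [x Ux|v].
    have [cf df] := Cn0 Cf Ux; split=> [|v].
      exact: (continuous_comp cf (@coord_continuous _ _ _ 0 j _)).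
    by move/derivable_mxP: (df v); exact.
  apply: Cn_ext ((IH _).1 (Cf.2 v) j) => // x Ux.
  by apply: derive_coord; exact: (Cn0 Cf Ux).2.
have df x v : U x -> derivable f x v.
  by move=> Ux; apply/derivable_mxP => i j; rewrite ord1; exact: (Cn0 (Cf j) Ux).2.
split=> [x Ux|v].
  split=> [|v]; last exact: df.
  by apply: continuous_rV => j; exact: (Cn0 (Cf j) Ux).1.
apply/IH => j; apply: Cn_ext ((Cf j).2 v) => // x Ux.
by rewrite derive_coord//; exact: df.
Qed.

Lemma smooth_coordP N (f : V -> 'rV[R]_N) :
  smooth_on U f <-> forall j, smooth_on U (fun x => f x 0 j).
Proof.
split=> [/smooth_onP sf j|sf]; apply/smooth_onP => n.
  exact: (Cn_coord _ _).1.
by apply/Cn_coord => j; exact: (smooth_onP _ _).1.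
Qed.

Lemma smooth_scale N (c : V -> R) (f : V -> 'rV[R]_N) :
  smooth_on U c -> smooth_on U f -> smooth_on U (fun x => c x *: f x).
Proof.
move=> sc /smooth_coordP sf; apply/smooth_coordP => j.
by apply: smooth_ext (smooth_mul sc (sf j)) => x _; rewrite mxE.
Qed.

Lemma smooth_dotv N (f g : V -> 'rV[R]_N) :
  smooth_on U f -> smooth_on U g -> smooth_on U (fun x => dotv (f x) (g x)).
Proof.
move=> /smooth_coordP sf /smooth_coordP sg.
have S := @smooth_sum _ _ (index_enum 'I_N) xpredT _ (fun i _ => smooth_mul (sf i) (sg i)).
apply: smooth_ext S => x _.
by rewrite /dotv mxE; apply: eq_bigr => i _; rewrite mxE.
Qed.

(** The difference quotient along [v] is constantly [L v], so the first derivatives are constant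
    maps. *)
Lemma smooth_linear (W : normedModType R) (L : V -> W) :
  linear L -> continuous L -> smooth_on U L.
Proof.
move=> lL cL; have eL x v : (fun h => h^-1 *: ((L \o shift x) (h *: v) - L x)) @ 0^'
    --> L v.
  apply: cvg_near_cst; near=> h.
  have h0 : h != 0 by near: h; exact: nbhs_dnbhs_neq.
  by rewrite /= lL addrK scalerA mulVf // scale1r.
apply/smooth_onP => n.
case: n => [|n]; (split; first by move=> x _; split=> [|v];
  [exact: cL|apply/cvg_ex; exists (L v); exact: eL]) => //.
move=> v; apply: Cn_ext (Cn_cst n U (L v)) => // x _.
by symmetry; apply: cvg_lim (eL x v).
Unshelve. all: by end_near. Qed.

End Smooth.

Lemma growth_rate_comp_linear (V V' W : normedModType R) (L : V -> V') (f : V' -> W)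
    x v : linear L ->
  (fun h => h^-1 *: (((fun y => f (L y)) \o shift x) (h *: v) - f (L x))) =
  (fun h => h^-1 *: ((f \o shift (L x)) (h *: L v) - f (L x))).
Proof. by move=> lL; apply/funext => h /=; rewrite lL. Qed.

Lemma derive_comp_linear (V V' W : normedModType R) (L : V -> V') (f : V' -> W) x v :
  linear L -> derive (fun x => f (L x)) x v = derive f (L x) (L v).
Proof. by move=> lL; rewrite /derive growth_rate_comp_linear. Qed.

(** The difference quotients of [f \o L] at [x] along [v] are those of [f] at [L x] along [L v], so
    [L] passes through iterated derivatives one direction at a time. The inner maps met below are
    projections and permutations of coordinates, so this case of the chain rule suffices. *)
Lemma smooth_comp_linear (V V' W : normedModType R) (L : V -> V') (U : set V)
    (U' : set V') (f : V' -> W) :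
  linear L -> continuous L -> (forall x, U x -> U' (L x)) ->
  smooth_on U' f -> smooth_on U (fun x => f (L x)).
Proof.
move=> lL cL UU' sf vs x Ux.
have -> : Defs.iterD vs (fun x => f (L x)) = fun x => Defs.iterD (map L vs) f (L x).
  elim: vs => //= v vs ->; apply/funext => y; exact: (derive_comp_linear (Defs.iterD _ f) y v lL).
have [cf df] := sf (map L vs) _ (UU' _ Ux); split=> [|v].
  exact: (continuous_comp (cL x) cf).
rewrite /derivable (growth_rate_comp_linear (Defs.iterD _ f) x v lL).
exact: df.
Qed.

End SmoothCalculus.

(** * Orthonormal frames and derivatives of ruled maps *)

Section OrthonormalFrame.
Variable R : realType.

Lemma dotvDl N (u v w : 'rV[R]_N) : dotv (u + v) w = dotv u w + dotv v w.
Proof. by rewrite /dotv mulmxDl mxE. Qed.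

Lemma dotvZl N (c : R) (u w : 'rV[R]_N) : dotv (c *: u) w = c * dotv u w.
Proof. by rewrite /dotv -scalemxAl mxE. Qed.

Lemma dotvC N (u w : 'rV[R]_N) : dotv u w = dotv w u.
Proof. by rewrite /dotv !mxE; apply: eq_bigr => i _; rewrite !mxE mulrC. Qed.

Lemma dotv_eq0 N (u : 'rV[R]_N) : (dotv u u == 0) = (u == 0).
Proof.
apply/eqP/eqP => [|->]; last by rewrite /dotv mul0mx mxE.
rewrite /dotv mxE => /eqP; rewrite psumr_eq0 => [/allP u0|i _]; last first.
  by rewrite mxE -expr2 sqr_ge0.
apply/rowP => i; have := u0 i (mem_index_enum i).
by rewrite !mxE /= mulf_eq0 orbb => /eqP.
Qed.

Lemma row_free_ker m N (A : 'M[R]_(m, N)) :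
  (forall a : 'rV_m, a *m A = 0 -> a = 0) -> row_free A.
Proof.
by move=> A0; rewrite -kermx_eq0; apply/eqP/row_matrixP => i; rewrite row0;
  apply: A0; rewrite -row_mul mulmx_ker row0.
Qed.

Definition frame k N (X : 'I_k -> R -> 'rV[R]_N) (t : R) : 'M[R]_(k, N) :=
  \matrix_(j < k) X j t.

Lemma mul_frame k N (X : 'I_k -> R -> 'rV[R]_N) t (a : 'rV[R]_k) :
  a *m frame X t = \sum_(j < k) a 0 j *: X j t.
Proof. by rewrite mulmx_sum_row; apply: eq_bigr => j _; rewrite rowK. Qed.

Lemma frame_sub k N (X : 'I_k -> R -> 'rV[R]_N) t j : (X j t <= frame X t)%MS.
Proof. by rewrite -[X j t](rowK (fun j => X j t)) row_sub. Qed.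

Lemma frame_orthonormal k N (X : 'I_k -> R -> 'rV[R]_N) t :
  (forall i j, dotv (X i t) (X j t) = (i == j)%:R) ->
  frame X t *m (frame X t)^T = 1%:M.
Proof.
move=> oX; apply/matrixP => i j; rewrite [RHS]mxE -oX /dotv !mxE.
by apply: eq_bigr => l _; rewrite !mxE.
Qed.

Variables (k N : nat) (M : 'M[R]_(k, N)).

(** When the rows of [M] are orthonormal, [M^T *m M] is the orthogonal projection onto their span,
    and this is the projection onto its orthogonal complement. *)
Definition normal_part (w : 'rV[R]_N) : 'rV[R]_N := w - w *m M^T *m M.

Lemma normal_partD u w : normal_part (u + w) = normal_part u + normal_part w.
Proof. by rewrite /normal_part !mulmxDl opprD addrACA. Qed.

Lemma normal_partZ c w : normal_part (c *: w) = c *: normal_part w.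
Proof. by rewrite /normal_part -!scalemxAl scalerBr. Qed.

Lemma normal_part_sum (I : finType) (F : I -> 'rV[R]_N) :
  normal_part (\sum_i F i) = \sum_i normal_part (F i).
Proof.
apply: (big_morph normal_part normal_partD).
by rewrite /normal_part !mul0mx subrr.
Qed.

Hypothesis MM : M *m M^T = 1%:M.

Lemma orthonormal_row_free : row_free M.
Proof. by apply/row_freeP; exists M^T. Qed.

Lemma normal_part_eq0 w : (normal_part w == 0) = (w <= M)%MS.
Proof.
rewrite subr_eq0; apply/eqP/idP => [->|/submxP[a ->]]; first exact: submxMl.
by rewrite -(mulmxA a M) MM mulmx1.
Qed.

Lemma normal_part_sub w : (w <= M)%MS -> normal_part w = 0.
Proof. by rewrite -normal_part_eq0 => /eqP. Qed.

Lemma normal_partZD c u w : (w <= M)%MS -> normal_part (c *: u + w) = c *: normal_part u.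
Proof. by move=> wM; rewrite normal_partD normal_partZ (normal_part_sub wM) addr0. Qed.

(** The part removed from [u] lies in the row space of [M], to which [normal_part w] is
    orthogonal. *)
Lemma dotv_normal_part u w : dotv (normal_part u) (normal_part w) = dotv u (normal_part w).
Proof.
rewrite {1}/normal_part -scaleN1r dotvDl dotvZl [X in _ + _ * X](_ : _ = 0).
  by rewrite mulr0 addr0.
rewrite /dotv /normal_part linearB /= !trmx_mul trmxK mulmxBr -!mulmxA.
by rewrite (mulmxA M) MM mul1mx subrr mxE.
Qed.

End OrthonormalFrame.

(** * First derivatives of ruled maps *)

Section RuledDerivatives.
Variable R : realType.

Lemma is_derive_scale (V : normedModType R) N (c : V -> R) (F : V -> 'rV[R]_N)
    x v (dc : R) (dF : 'rV[R]_N) :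
  is_derive x v c dc -> is_derive x v F dF ->
  is_derive x v (fun y => c y *: F y) (c x *: dF + dc *: F x).
Proof.
move=> [cx <-] [Fx <-].
have dFx j : derivable (fun y => F y 0 j) x v by move/derivable_mxP/(_ 0 j): Fx.
have cFE j : (fun y => (c y *: F y) 0 j) = c * (fun y => F y 0 j).
  by apply/funext => y; rewrite mxE.
have dcF : derivable (fun y => c y *: F y) x v.
  by apply/derivable_mxP => i j; rewrite ord1 cFE; exact: (derivableM cx (dFx j)).
apply: DeriveDef => //; apply/rowP => j.
rewrite (derive_coord j dcF) cFE (deriveM cx (dFx j)) !mxE (derive_coord j Fx).
by congr (_ + _); exact: mulrC.
Qed.

Lemma derive_dir (W : normedModType R) (F : R -> W) t s :
  derivable F t 1 -> derivable F t s /\ derive F t s = s *: derive F t 1.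
Proof.
move=> /derivable1_diffP dF; split; first exact: diff_derivable.
by rewrite !deriveE// -[s in LHS]mulr1 [LHS]linearZ.
Qed.

Variables (k N : nat).

Lemma tcoord_linear : linear (@tcoord R k).
Proof. by move=> a u v; rewrite /tcoord !mxE. Qed.

Lemma tcoord_continuous : continuous (@tcoord R k).
Proof. exact: coord_continuous. Qed.

Lemma coord_linear p (i : 'I_p) : linear (fun x : 'rV[R]_p => x 0 i).
Proof. by move=> a u v; rewrite !mxE. Qed.

Lemma is_derive_coord p (i : 'I_p) (x v : 'rV[R]_p) :
  is_derive x v (fun y : 'rV[R]_p => y 0 i) (v 0 i).
Proof.
have dx : derivable (@id 'rV[R]_p) x v by exact: derivable_id.
apply: DeriveDef; first by move/derivable_mxP/(_ 0 i): dx.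
by rewrite -(derive_coord _ dx) derive_id.
Qed.

Lemma is_derive_tcoord (W : normedModType R) (F : R -> W) (x v : 'rV[R]_k.+1) :
  derivable F (tcoord x) 1 ->
  is_derive x v (fun y => F (tcoord y)) (tcoord v *: derive F (tcoord x) 1).
Proof.
move=> dF1; have [dF <-] := derive_dir (tcoord v) dF1.
apply: DeriveDef; last exact: (derive_comp_linear F x v tcoord_linear).
by rewrite /derivable (growth_rate_comp_linear F x v tcoord_linear).
Qed.

(** The t-part is written as a ruled map again, with data [g'] and [X'], so that the same lemma also
    yields second derivatives. *)
Lemma is_derive_ruled (g : R -> 'rV[R]_N) (X : 'I_k -> R -> 'rV[R]_N)
    (x v : 'rV[R]_k.+1) :
  derivable g (tcoord x) 1 -> (forall j, derivable (X j) (tcoord x) 1) ->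
  is_derive x v (ruled_map g X)
    (tcoord v *: ruled_map (fun t => derive g t 1) (fun j t => derive (X j) t 1) x +
     \sum_(j < k) ucoord v j *: X j (tcoord x)).
Proof.
move=> dg dX.
have D := is_deriveD (is_derive_tcoord v dg) (is_derive_sum (fun j => is_derive_scale
  (is_derive_coord (lift ord0 j) x v) (is_derive_tcoord v (dX j)))).
apply: is_derive_eq; first (move: D; set A := (X in is_derive _ _ X _)).
  rewrite (_ : A = ruled_map g X); last first.
    by apply/funext => y; rewrite /A/ruled_map /= fct_sumE.
  by move=> D; exact: D.
rewrite /ruled_map scalerDr -addrA big_split /= scaler_sumr.
congr (_ + (_ + _)); apply: eq_bigr => j _.
by rewrite !scalerA mulrC.
Qed.

End RuledDerivatives.

(** * The rank-one condition *)

Section RankOne.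
Variables (R : realType) (k N : nat) (I : set R).
Variables (g : R -> 'rV[R]_N) (X : 'I_k -> R -> 'rV[R]_N).

Let g' t := derive g t 1.
Let X' j t := derive (X j) t 1.

Lemma tcoord_ev0 : tcoord (ev R (ord0 : 'I_k.+1)) = 1.
Proof. by rewrite /tcoord /ev mxE !eqxx. Qed.

Lemma tcoord_ev_lift (j : 'I_k) : tcoord (ev R (lift ord0 j)) = 0.
Proof. by rewrite /tcoord /ev mxE. Qed.

Lemma ucoord_ev0 (l : 'I_k) : ucoord (ev R ord0) l = 0.
Proof. by rewrite /ucoord /ev mxE. Qed.

Lemma ucoord_ev_lift (j l : 'I_k) : ucoord (ev R (lift ord0 j)) l = (l == j)%:R.
Proof. by rewrite /ucoord /ev mxE eqxx (inj_eq lift_inj). Qed.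

Lemma sum_delta (V : lmodType R) (n : nat) (j : 'I_n) (F : 'I_n -> V) :
  \sum_(l < n) (l == j)%:R *: F l = F j.
Proof.
rewrite (bigD1 j) //= eqxx scale1r big1 ?addr0 // => l /negbTE ->.
by rewrite scale0r.
Qed.

Lemma collinear_of_sum (V : lmodType R) (n : nat) (b : R) (v w : V) (u : 'I_n -> R)
    (p : 'I_n -> V) :
  b *: v = w + \sum_j u j *: p j -> (forall j, exists c, p j = c *: v) ->
  exists c, w = c *: v.
Proof.
move=> /eqP; rewrite -subr_eq => /eqP <- /choice[c cE].
exists (b - \sum_j u j * c j); rewrite scalerBl scaler_suml; congr (_ - _).
by apply: eq_bigr => j _; rewrite cE scalerA.
Qed.

Lemma open_ruled_domain : open I -> open (ruled_domain k I).
Proof.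
by move=> oI; apply: open_comp => // x _; exact: tcoord_continuous.
Qed.

Lemma derive_ruled_t x :
  derivable g (tcoord x) 1 -> (forall j, derivable (X j) (tcoord x) 1) ->
  derive (ruled_map g X) x (ev R ord0) = ruled_map g' X' x.
Proof.
move=> dg dX; have [_ ->] := is_derive_ruled (ev R ord0) dg dX.
by rewrite tcoord_ev0 scale1r big1 ?addr0// => j _; rewrite ucoord_ev0 scale0r.
Qed.

Lemma derive_ruled_u x j :
  derivable g (tcoord x) 1 -> (forall j, derivable (X j) (tcoord x) 1) ->
  derive (ruled_map g X) x (ev R (lift ord0 j)) = X j (tcoord x).
Proof.
move=> dg dX; have [_ ->] := is_derive_ruled (ev R (lift ord0 j)) dg dX.
rewrite tcoord_ev_lift scale0r add0r.
under eq_bigr do rewrite ucoord_ev_lift.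
exact: (sum_delta j (fun l => X l (tcoord x))).
Qed.

Hypothesis data : ruled_data I g X.
Let oI : open I. Proof. exact: data.1.1.1. Qed.
Let sg : smooth_on I g. Proof. exact: data.1.2.1. Qed.
Let sX j : smooth_on I (X j). Proof. exact: (data.2.1 j). Qed.
Let dg t : I t -> derivable g t 1. Proof. by move=> It; exact: smooth_derivable sg It. Qed.
Let dX t j : I t -> derivable (X j) t 1.
Proof. by move=> It; exact: smooth_derivable (sX j) It. Qed.
Let MM t : I t -> frame X t *m (frame X t)^T = 1%:M.
Proof. by move=> It; exact: frame_orthonormal (data.2.2 t It). Qed.

Let nrm t := normal_part (frame X t).

Lemma nullity_space_sub p (f : 'rV[R]_p -> 'rV[R]_N) x (a : 'rV_p) :
  (a <= nullity_space f x)%MS = [forall j, (a *m hess f j x <= jac f x)%MS].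
Proof.
apply/sub_bigcapmxP/forallP => h j; first by rewrite submxE -mulmxA -sub_kermx h.
by move=> _; rewrite sub_kermx mulmxA -submxE.
Qed.

Lemma mul_jac p (f : 'rV[R]_p -> 'rV[R]_N) x (a : 'rV_p) :
  a *m jac f x = \sum_i a 0 i *: derive f x (ev R i).
Proof. by rewrite mulmx_sum_row; apply: eq_bigr => i _; rewrite rowK. Qed.

Lemma mul_hess p (f : 'rV[R]_p -> 'rV[R]_N) x j (a : 'rV_p) :
  a *m hess f j x = \sum_i a 0 i *: derive (fun y => derive f y (ev R j)) x (ev R i).
Proof. by rewrite mulmx_sum_row; apply: eq_bigr => i _; rewrite rowK. Qed.

Let f := ruled_map g X.

(** The derivative along the [j]-th ruling coordinate is [X j] at [tcoord y], a function of [t]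
    alone, so only the t-component of [a] contributes. *)
Lemma hess_ruled_u (a : 'rV_k.+1) j x : I (tcoord x) ->
  a *m hess f (lift ord0 j) x = a 0 ord0 *: X' j (tcoord x).
Proof.
move=> Ix; rewrite mul_hess.
have E v : derive (fun y => derive f y (ev R (lift ord0 j))) x v =
    tcoord v *: X' j (tcoord x).
  have [_ <-] := is_derive_tcoord v (@dX _ j Ix).
  apply: near_eq_derive; near=> y.
  have Iy : ruled_domain k I y
    by near: y; apply: open_nbhs_nbhs; split=> //; exact: open_ruled_domain.
  by apply: derive_ruled_u => [|l]; [exact: dg|exact: dX].
rewrite big_ord_recl big1 ?addr0 => [|l _]; rewrite E.
  by rewrite tcoord_ev0 scale1r.
by rewrite tcoord_ev_lift scale0r scaler0.
Unshelve. all: by end_near. Qed.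

(** Here the t-derivative is taken first. It is a ruled map, affine in [u] with coefficients [X' j],
    so this mixed derivative is found directly, without appeal to the symmetry of second
    derivatives. *)
Lemma hess_ruled_tu j x : I (tcoord x) ->
  ev R (lift ord0 j) *m hess f ord0 x = X' j (tcoord x).
Proof.
move=> Ix; rewrite mul_hess (bigD1 (lift ord0 j)) //= big1 => [|i ij]; last first.
  by rewrite /ev mxE eqxx (negbTE ij) scale0r.
rewrite addr0 /ev mxE !eqxx scale1r.
rewrite (near_eq_derive (g := ruled_map g' X')); last first.
  near=> y.
  have Iy : ruled_domain k I y
    by near: y; apply: open_nbhs_nbhs; split=> //; exact: open_ruled_domain.
  by apply: derive_ruled_t => [|l]; [exact: dg|exact: dX].
have sg' : smooth_on I g' := smooth_derive (1 : R) sg.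
have sX' l : smooth_on I (X' l) := smooth_derive (1 : R) (@sX l).
have dg' : derivable g' (tcoord x) 1 by exact: smooth_derivable sg' Ix.
have dX' l : derivable (X' l) (tcoord x) 1 by exact: smooth_derivable (sX' l) Ix.
have [_ ->] := is_derive_ruled (ev R (lift ord0 j)) dg' dX'.
rewrite tcoord_ev_lift scale0r add0r.
under eq_bigr do rewrite ucoord_ev_lift.
exact: (sum_delta j (fun l => X' l (tcoord x))).
Unshelve. all: by end_near. Qed.

(** If [X' j] were not tangent, the rows of the Hessian along [u_j] would force every nullity vector
    to have zero t-component. The nullity space, of dimension [k], would then be the whole
    hyperplane of ruling directions, and the [j]-th of these, paired with the t-direction, would
    make [X' j] tangent after all. *)
Lemma rulings_in_nullity x j : I (tcoord x) ->
  relative_nullity f x = k -> (X' j (tcoord x) <= jac f x)%MS.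
Proof.
move=> Ix nk; apply: contrapT => /negP nXj.
(* The hyperplane of parameter vectors with zero t-component. *)
pose H := kermx (ev R (ord0 : 'I_k.+1))^T.
have inH (a : 'rV_k.+1) : (a <= H)%MS = (a 0 ord0 == 0).
  rewrite sub_kermx; have -> : a *m (ev R ord0)^T = (a 0 ord0)%:M.
    rewrite /ev trmx_delta; apply/rowP => i; rewrite !mxE (bigD1 ord0) //= big1.
      by rewrite !mxE ord1 !eqxx mulr1 addr0.
    by move=> l l0; rewrite mxE (negbTE l0) mulr0.
  apply/eqP/eqP => [/matrixP/(_ 0 0)|->]; first by rewrite !mxE eqxx.
  by apply/matrixP => i l; rewrite !mxE mul0rn.
have sNH : (nullity_space f x <= H)%MS.
  apply/row_subP => i; rewrite inH.
  have := row_sub i (nullity_space f x).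
  rewrite nullity_space_sub => /forallP/(_ (lift ord0 j)).
  rewrite hess_ruled_u//; apply: contraTT => a0; apply: contra nXj => h.
  by rewrite -[X' j _](scalerK a0) scalemx_sub.
have rH : \rank H = k.
  rewrite mxrank_ker mxrank_tr (_ : \rank (ev R ord0) = 1%N) ?subn1//.
  apply/eqP; rewrite eqn_leq rank_leq_row lt0n mxrank_eq0.
  by apply/eqP => /matrixP/(_ 0 ord0); rewrite !mxE !eqxx => /eqP; rewrite oner_eq0.
have sHN : (H <= nullity_space f x)%MS.
  by have [_ <-] := mxrank_leqif_sup sNH; rewrite rH eq_sym; exact/eqP.
have : (ev R (lift ord0 j) <= nullity_space f x)%MS.
  by apply: submx_trans sHN; rewrite inH /ev mxE.
rewrite nullity_space_sub => /forallP/(_ ord0); rewrite hess_ruled_tu//.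
exact/negP.
Qed.

(** Taking the normal part of a linear relation among the partial derivatives leaves only its
    t-term, so the t-coefficient vanishes. What remains is a relation in an orthonormal frame. *)
Lemma regular_ruled x : I (tcoord x) ->
  nrm (tcoord x) (ruled_map g' X' x) != 0 -> regular_at f x.
Proof.
move=> Ix q0; apply: row_free_ker => a.
have jacE : a *m jac f x = a 0 ord0 *: ruled_map g' X' x +
    (\row_j a 0 (lift ord0 j)) *m frame X (tcoord x).
  rewrite mul_jac big_ord_recl mul_frame derive_ruled_t; [|exact: dg|by move=> l; exact: dX].
  congr (_ + _); apply: eq_bigr => j _.
  by rewrite mxE derive_ruled_u; [|exact: dg|by move=> l; exact: dX].
rewrite jacE => a0.
have : nrm (tcoord x) 0 = a 0 ord0 *: nrm (tcoord x) (ruled_map g' X' x).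
  by rewrite -a0; apply: (normal_partZD (MM Ix)); exact: submxMl.
rewrite /nrm [LHS](normal_part_sub (MM Ix)) ?sub0mx// => /esym/eqP.
rewrite scaler_eq0 (negbTE q0) orbF => /eqP a00.
move: a0; rewrite a00 scale0r add0r -[RHS](mul0mx _ (frame X (tcoord x))).
move/(row_free_inj (orthonormal_row_free (MM Ix)))/rowP => aj.
apply/rowP => i; rewrite mxE; case: (unliftP ord0 i) => [j ->|-> //].
by have := aj j; rewrite !mxE.
Qed.

Lemma normal_tangent x (w : 'rV_N) : I (tcoord x) -> (w <= jac f x)%MS ->
  exists c, nrm (tcoord x) w = c *: nrm (tcoord x) (ruled_map g' X' x).
Proof.
move=> Ix /submxP[a ->]; exists (a 0 ord0).
rewrite mul_jac big_ord_recl derive_ruled_t; [|exact: dg|by move=> l; exact: dX].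
apply: (normal_partZD (MM Ix)).
apply: summx_sub => j _; apply: scalemx_sub; rewrite derive_ruled_u ?frame_sub//.
- exact: dg.
- by move=> l; exact: dX.
Qed.

Hypothesis r1 : rank_one (ruled_domain k I) f.

Lemma normal_parts_collinear t j0 : I t -> nrm t (X' j0 t) != 0 ->
  (forall j, exists c, nrm t (X' j t) = c *: nrm t (X' j0 t)) /\
  exists c, nrm t (g' t) = c *: nrm t (X' j0 t).
Proof.
move=> It p0.
have nrmE x : nrm (tcoord x) (ruled_map g' X' x) = nrm (tcoord x) (g' (tcoord x)) +
    \sum_j ucoord x j *: nrm (tcoord x) (X' j (tcoord x)).
  rewrite /nrm /ruled_map normal_partD normal_part_sum; congr (_ + _).
  by apply: eq_bigr => j _; rewrite normal_partZ.
(* A regular point over [t]: if the normal part of [g'] is nonzero, the point with [u = 0] serves.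
   Otherwise [u] is the [j0]-th unit vector, where the normal part of the t-derivative is that of
   [X' j0]. *)
have [x [xt q0]] : exists x : 'rV[R]_k.+1, tcoord x = t /\ nrm t (ruled_map g' X' x) != 0.
  pose x0 : 'rV[R]_k.+1 := t *: ev R ord0.
  have tx0 : tcoord x0 = t by rewrite /x0 /tcoord !mxE !eqxx mulr1.
  have [g0|g0] := eqVneq (nrm t (g' t)) 0; last first.
    exists x0; split=> //; have := nrmE x0; rewrite tx0 => ->; rewrite big1 ?addr0//.
    by move=> j _; rewrite /x0 /ucoord !mxE mulr0 scale0r.
  pose x1 := x0 + ev R (lift ord0 j0).
  have tx1 : tcoord x1 = t by rewrite /x1 /tcoord [LHS]mxE [X in X + _]tx0 mxE addr0.
  exists x1; split=> //; have := nrmE x1; rewrite tx1 => ->; rewrite g0 add0r.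
  under eq_bigr => j _.
    have -> : ucoord x1 j = (j == j0)%:R.
      by rewrite /ucoord !mxE mulr0 add0r eqxx (inj_eq lift_inj).
    over.
  by rewrite sum_delta.
have Ix : I (tcoord x) by rewrite xt.
have reg : regular_at f x by apply: regular_ruled => //; rewrite xt.
have ex j : exists c, nrm t (X' j t) = c *: nrm t (ruled_map g' X' x).
  by rewrite -xt; apply: normal_tangent => //; apply: rulings_in_nullity => //; exact: r1.
have [c0 E0] := ex j0.
have c0n : c0 != 0 by apply: contraNneq p0 => c00; rewrite E0 c00 scale0r.
have qE : nrm t (ruled_map g' X' x) = c0^-1 *: nrm t (X' j0 t) by rewrite E0 scalerK.
have ex' j : exists c, nrm t (X' j t) = c *: nrm t (X' j0 t).
  by have [c ->] := ex j; exists (c * c0^-1); rewrite qE scalerA.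
(* In the expansion of the normal part at [x], every term except that of [g'] is by now a multiple
   of the normal part of [X' j0]; solve for the remaining one. *)
split=> //; have := nrmE x; rewrite xt qE => E.
exact: collinear_of_sum E ex'.
Qed.

End RankOne.

(** * Local models and cylinders *)

Section LocalModels.
Variables (R : realType) (k N : nat).

Definition local_model (D : set 'rV[R]_k.+1) (f : 'rV[R]_k.+1 -> 'rV[R]_N)
    (x : 'rV[R]_k.+1) : Prop :=
  exists (V V' : set 'rV[R]_k.+1) (phi : 'rV[R]_k.+1 -> 'rV[R]_k.+1)
         (F : 'rV[R]_k.+1 -> 'rV[R]_N),
    V x /\ V `<=` D /\ diffeo V V' phi /\ (forall y, V y -> f y = F (phi y)) /\
    (cylinder_model V' F \/ cone_model V' F \/ tangent_model V' F).

(** Take for [W] the set of all points with a local model in [D]. A chart domain [V] serves each of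
    its own points, so [W] is open and contains [V]. *)
Lemma local_models_dense (D : set 'rV[R]_k.+1) (f : 'rV[R]_k.+1 -> 'rV[R]_N) :
  (forall x (O : set 'rV[R]_k.+1), D x -> nbhs x O -> exists2 y, O y & local_model D f y) ->
  exists W : set 'rV[R]_k.+1, open W /\ W `<=` D /\ D `<=` closure W /\
    forall x, W x -> local_model W f x.
Proof.
move=> dense; exists [set x | local_model D f x].
split; last split; last split.
- rewrite openE => x [V [V' [phi [F [Vx [VD [dphi rest]]]]]]].
  rewrite /interior; apply: filterS (open_nbhs_nbhs (conj dphi.1 Vx)) => y Vy.
  by exists V, V', phi, F.
- by move=> x [V [V' [phi [F [Vx [VD _]]]]]]; exact: VD.
- by move=> x Dx O xO; have [y Oy ly] := dense x O Dx xO; exists y.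
- move=> x [V [V' [phi [F [Vx [VD rest]]]]]].
  exists V, V', phi, F; split; [exact: Vx|split; last exact: rest].
  by move=> y Vy; exists V, V', phi, F.
Qed.

Definition join (t : R) (u : 'rV[R]_k) : 'rV[R]_k.+1 :=
  \row_i (if unlift ord0 i is Some j then u 0 j else t).

Definition upart (x : 'rV[R]_k.+1) : 'rV[R]_k := \row_j ucoord x j.

Lemma tcoord_join t u : tcoord (join t u) = t.
Proof. by rewrite /tcoord mxE unlift_none. Qed.

Lemma join_lift t u j : join t u 0 (lift ord0 j) = u 0 j.
Proof. by rewrite mxE liftK. Qed.

Lemma upart_join t u : upart (join t u) = u.
Proof. by apply/rowP => j; rewrite mxE /ucoord join_lift. Qed.

Lemma join_parts x : join (tcoord x) (upart x) = x.
Proof.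
apply/rowP => i; rewrite mxE; case: unliftP => [j ->|->] //.
by rewrite mxE.
Qed.

Lemma ruled_mapE (g : R -> 'rV[R]_N) (X : 'I_k -> R -> 'rV[R]_N) x :
  ruled_map g X x = g (tcoord x) + upart x *m frame X (tcoord x).
Proof. by rewrite mul_frame; congr (_ + _); apply: eq_bigr => j _; rewrite mxE. Qed.

Lemma smooth_tcoord (W : normedModType R) (J : set R) (h : R -> W) :
  smooth_on J h -> smooth_on (ruled_domain k J) (fun x => h (tcoord x)).
Proof.
exact: (smooth_comp_linear (@tcoord_linear R k) (@tcoord_continuous R k)).
Qed.

Lemma smooth_row_coord p (U : set 'rV[R]_p) (i : 'I_p) : open U ->
  smooth_on U (fun x : 'rV[R]_p => x 0 i).
Proof.
by move=> oU; apply: smooth_linear => //;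
  [exact: coord_linear|exact: coord_continuous].
Qed.

Lemma smooth_join_mulmx (J : set R) (A : R -> 'M[R]_k) : open J ->
  (forall i j, smooth_on J (fun t => A t i j)) ->
  smooth_on (ruled_domain k J) (fun x => join (tcoord x) (upart x *m A (tcoord x))).
Proof.
move=> oJ sA; have oD := open_ruled_domain (k := k) oJ.
apply/(smooth_coordP oD) => i; case: (unliftP ord0 i) => [j ->|->].
  have S := @smooth_sum _ _ _ oD _ _ (index_enum 'I_k) xpredT _ (fun l _ =>
    smooth_mul oD (smooth_row_coord (lift ord0 l) oD) (smooth_tcoord (sA l j))).
  apply: smooth_ext S => // x _; rewrite join_lift mxE.
  by apply: eq_bigr => l _; rewrite mxE.
apply: smooth_ext (smooth_row_coord ord0 oD) => // x _.
by rewrite -[RHS]/(tcoord _) tcoord_join.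
Qed.

End LocalModels.

(** * Rulings parallel to a fixed subspace *)

Section Cylinder.
Variable R : realType.

Lemma is_derive_mulmx m n p (B : R -> 'M[R]_(m, n)) (C : R -> 'M[R]_(n, p)) t
    (B' : 'M[R]_(m, n)) (C' : 'M[R]_(n, p)) :
  (forall i j, is_derive t (1 : R) (fun s => B s i j) (B' i j)) ->
  (forall i j, is_derive t (1 : R) (fun s => C s i j) (C' i j)) ->
  forall i j, is_derive t (1 : R) (fun s => (B s *m C s) i j) ((B' *m C t + B t *m C') i j).
Proof.
move=> dB dC i j.
have D := is_derive_sum (fun l => is_deriveM (dB i l) (dC l j)).
have E : (fun s => (B s *m C s) i j) =
    \sum_(l < n) ((fun s => B s i l) * (fun s => C s l j)).
  by apply/funext => s; rewrite mxE fct_sumE.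
have <- : \sum_(l < n) (B t i l *: C' l j + C t l j *: B' i l) =
    (B' *m C t + B t *m C') i j; last by rewrite E; exact: D.
rewrite !mxE -big_split /=; apply: eq_bigr => l _.
by rewrite addrC; congr (_ + _); exact: mulrC.
Qed.

Lemma is_derive_unique (f : R -> R) (t a b : R) :
  is_derive t (1 : R) f a -> is_derive t (1 : R) f b -> a = b.
Proof. by move=> [_ <-] [_ <-]. Qed.

Lemma constant_on_interval (J : set R) (f : R -> R) s t : is_interval J ->
  (forall x, J x -> is_derive x (1 : R) f 0) -> J s -> J t -> f s = f t.
Proof.
move=> iJ df; wlog st : s t / s <= t.
  by move=> H Js Jt; case/orP: (le_total s t) => st; [|symmetry]; exact: H.
move=> Js Jt; have Jst x : x \in `[s, t] -> J x.
  by rewrite in_itv /= => xst; exact: (iJ _ _ Js Jt _ xst).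
have dfo x : x \in `]s, t[ -> is_derive x (1 : R) f 0.
  by move=> xst; apply: df; apply: Jst; exact: subset_itv_oo_cc xst.
have cf : {within `[s, t], continuous f}.
  apply: derivable_within_continuous => x xst.
  exact: (@ex_derive _ _ _ _ _ _ _ (df _ (Jst _ xst))).
have [c _] := MVT_segment st dfo cf.
by rewrite mul0r => /subr0_eq.
Qed.

Variables (k N : nat) (J : set R) (X : 'I_k -> R -> 'rV[R]_N).
Hypotheses (oJ : open J) (iJ : is_interval J).
Hypothesis sX : forall j, smooth_on J (X j).
Hypothesis oX : forall t, J t -> forall i j, dotv (X i t) (X j t) = (i == j)%:R.
Let X' j t := derive (X j) t 1.
Hypothesis X'0 : forall t, J t -> forall j, (X' j t <= frame X t)%MS.
Let M := frame X.
Let A := frame X'.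

Let MM t : J t -> M t *m (M t)^T = 1%:M.
Proof. by move=> Jt; exact: frame_orthonormal (oX Jt). Qed.

Let is_derive_frame t j p : J t -> is_derive t (1 : R) (fun s => M s j p) (A t j p).
Proof.
move=> Jt; have dX : derivable (X j) t 1 := smooth_derivable (sX j) Jt.
have -> : (fun s => M s j p) = (fun s => X j s 0 p) by apply/funext => s; rewrite mxE.
rewrite mxE; apply: DeriveDef; first by move/derivable_mxP/(_ 0 p): dX.
by rewrite -(derive_coord p dX).
Qed.

Let is_derive_frame_tr t p j : J t -> is_derive t (1 : R) (fun s => (M s)^T p j) ((A t)^T p j).
Proof.
move=> Jt; have -> : (fun s => (M s)^T p j) = (fun s => M s j p).
  by apply/funext => s; rewrite mxE.
by rewrite mxE; exact: is_derive_frame.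
Qed.

(** Differentiate [M t *m (M t)^T = 1%:M], which holds near each point of [J]. *)
Lemma frame_derivative_skew t : J t -> A t *m (M t)^T + M t *m (A t)^T = 0.
Proof.
move=> Jt; apply/matrixP => i j; rewrite [RHS]mxE.
have D := is_derive_mulmx (fun i j => is_derive_frame i j Jt)
  (fun i j => is_derive_frame_tr i j Jt) i j.
apply: is_derive_unique D _.
apply: near_eq_is_derive (is_derive_cst ((1%:M : 'M[R]_k) i j) t 1).
near=> s; have Js : J s by near: s; exact: open_nbhs_nbhs.
by rewrite MM.
Unshelve. all: by end_near. Qed.

(** Since the rows of [A] lie in the ruling, [A = A *m M^T *m M]. Hence the derivative of [M^T *m M]
    is [M^T *m (M *m A^T + A *m M^T) *m M], which is zero by skewness. *)
Lemma frame_projection_constant s t : J s -> J t -> (M s)^T *m M s = (M t)^T *m M t.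
Proof.
move=> Js Jt; apply/matrixP => i j.
apply: (constant_on_interval (f := fun s => ((M s)^T *m M s) i j) iJ _ Js Jt) => x Jx.
have D := is_derive_mulmx (fun i j => is_derive_frame_tr i j Jx)
  (fun i j => is_derive_frame i j Jx) i j.
have AE : A x = A x *m (M x)^T *m M x.
  apply/row_matrixP => l; rewrite !row_mul; apply/eqP; rewrite -subr_eq0.
  rewrite -/(normal_part (M x) _) (normal_part_eq0 (MM Jx)) rowK.
  exact: X'0.
suff E : (A x)^T *m M x + (M x)^T *m A x = 0 by move: D; rewrite E mxE.
rewrite AE !trmx_mul trmxK -!mulmxA -mulmxDr (mulmxA (M x)) (mulmxA (A x)) -mulmxDl.
by rewrite addrC frame_derivative_skew// mul0mx mulmx0.
Qed.

Lemma cylinder_local_model (I : set R) (g : R -> 'rV[R]_N) x :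
  unit_speed_curve I g -> J `<=` I -> J (tcoord x) ->
  local_model (ruled_domain k I) (ruled_map g X) x.
Proof.
(* All frames over [J] span the same subspace, so [M t = B t *m M t0] with [B t] orthogonal.
   Replacing [u] by [u *m B t] makes the ruling vectors constant, and the transpose of [B t] gives
   the inverse change of parameters. *)
move=> ug JI Jx; pose t0 := tcoord x; pose B t := M t *m (M t0)^T.
have BBt t : J t -> B t *m (B t)^T = 1%:M.
  move=> Jt; rewrite /B trmx_mul trmxK mulmxA -(mulmxA (M t)).
  by rewrite (frame_projection_constant Jx Jt) mulmxA MM // mul1mx MM.
have BtB t : J t -> (B t)^T *m B t = 1%:M by move=> Jt; apply: mulmx1C; exact: BBt.
have sB i j : smooth_on J (fun t => B t i j).
  have S := smooth_dotv oJ (@sX i) (@smooth_cst _ _ J _ (X j t0)).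
  apply: smooth_ext S => // t _.
  by rewrite /dotv !mxE; apply: eq_bigr => l _; rewrite !mxE.
have sBt i j : smooth_on J (fun t => (B t)^T i j).
  by apply: (smooth_ext oJ _ (sB j i)) => t _; rewrite [RHS]mxE.
exists (ruled_domain k J), (ruled_domain k J),
  (fun y => join (tcoord y) (upart y *m B (tcoord y))),
  (ruled_map g (fun j _ => X j t0)).
split=> //; split; first by move=> y; exact: JI.
have oD := open_ruled_domain (k := k) oJ.
split; [|split; [|left]].
- split=> //; split=> //; split; first exact: smooth_join_mulmx.
  exists (fun y => join (tcoord y) (upart y *m (B (tcoord y))^T)).
  split; first exact: (smooth_join_mulmx (A := fun t => (B t)^T)).
  split=> y Jy; rewrite /ruled_domain /= tcoord_join upart_join; split=> //.
    by rewrite -mulmxA BBt// mulmx1 join_parts.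
  by rewrite -mulmxA BtB// mulmx1 join_parts.
- move=> y Jy; rewrite !ruled_mapE tcoord_join upart_join; congr (_ + _).
  rewrite -mulmxA; congr (_ *m _).
  rewrite -[frame (fun j _ => X j t0) _]/(M t0) /B -mulmxA (frame_projection_constant Jx Jy).
  by rewrite mulmxA MM // mul1mx.
exists I, g, (fun j => X j t0); split=> //; split; first exact: oX.
by split=> // y; exact: JI.
Qed.

End Cylinder.

(** * Cones and tangent submanifolds *)

Section ConeTangent.
Variables (R : realType) (p N : nat).

Let wid (l : 'I_p) : 'I_p.+1 := widen_ord (leqnSn p) l.

Lemma initc_linear : linear (@initc R p.+1).
Proof. by move=> a u v; apply/rowP => i; rewrite !mxE. Qed.

Lemma initc_continuous : continuous (@initc R p.+1).
Proof.
move=> x; apply: continuous_rV => j.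
rewrite (_ : (fun y => _) = (fun y : 'rV[R]_p.+2 => y 0 (widen_ord (leqnSn p.+1) j))).
  exact: coord_continuous.
by apply/funext => y; rewrite mxE.
Qed.

Lemma tcoord_initc (x : 'rV[R]_p.+2) : tcoord (initc x) = tcoord x.
Proof. by rewrite /tcoord mxE; congr (x _ _); exact: val_inj. Qed.

Lemma ucoord_initc (x : 'rV[R]_p.+2) l : ucoord (initc x) l = ucoord x (wid l).
Proof. by rewrite /ucoord mxE; congr (x _ _); exact: val_inj. Qed.

Lemma ucoord_max (x : 'rV[R]_p.+2) : ucoord x ord_max = lastc x.
Proof. by rewrite /ucoord; congr (x _ _); exact: val_inj. Qed.

Lemma initc_shear (x : 'rV[R]_p.+2) s : initc (x + s *: ev R ord_max) = initc x.
Proof.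
apply/rowP => j; rewrite !mxE eqxx -val_eqE /=.
by rewrite [_ == _]ltn_eqF ?ltn_ord// mulr0 addr0.
Qed.

Lemma lastc_shear (x : 'rV[R]_p.+2) s : lastc (x + s *: ev R ord_max) = lastc x + s.
Proof. by rewrite /lastc !mxE !eqxx mulr1. Qed.

Definition extend (s : R) (y : 'rV[R]_p.+1) : 'rV[R]_p.+2 :=
  \row_i (if unlift ord_max i is Some j then y 0 j else s).

Let lift_max (j : 'I_p.+1) : widen_ord (leqnSn p.+1) j = lift ord_max j.
Proof. by apply: val_inj; rewrite /= /bump leqNgt ltn_ord. Qed.

Lemma initc_extend s y : initc (extend s y) = y.
Proof. by apply/rowP => j; rewrite mxE lift_max mxE liftK. Qed.

Lemma extend_initc x : extend (lastc x) (initc x) = x.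
Proof.
apply/rowP => i; rewrite mxE; case: unliftP => [j ->|-> //].
by rewrite mxE lift_max.
Qed.

Lemma extend_continuous s : continuous (extend s).
Proof.
move=> x; apply: continuous_rV => i.
case: (unliftP ord_max i) => [j ->|->].
  rewrite (_ : (fun y => _) = (fun y : 'rV[R]_p.+1 => y 0 j)).
    exact: coord_continuous.
  by apply/funext => y; rewrite mxE liftK.
rewrite (_ : (fun y => _) = (fun=> s)); first exact: cst_continuous.
by apply/funext => y; rewrite mxE unlift_none.
Qed.

Variables (J : set R) (g : R -> 'rV[R]_N) (X : 'I_p.+1 -> R -> 'rV[R]_N).
(** The vector [e t] spans the line that contains all the normal parts: modulo the ruling, [g'] is
    [mu] times [e] and the derivative of [X j] is [lam j] times [e], scaled so that the last
    coefficient is 1. *)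
Variables (mu : R -> R) (lam : 'I_p.+1 -> R -> R) (e : R -> 'rV[R]_N).
Hypotheses (oJ : open J) (sg : smooth_on J g) (sX : forall j, smooth_on J (X j)).
Hypotheses (smu : smooth_on J mu) (slam : forall j, smooth_on J (lam j)).
Hypothesis oX : forall t, J t -> forall i j, dotv (X i t) (X j t) = (i == j)%:R.
Hypothesis g_e : forall t, J t -> (derive g t 1 - mu t *: e t <= frame X t)%MS.
Hypothesis X_e : forall t, J t -> forall j,
  (derive (X j) t 1 - lam j t *: e t <= frame X t)%MS.
Hypothesis lam_max : forall t, J t -> lam ord_max t = 1.

Let Om := ruled_domain p J.
Let oOm : open Om. Proof. exact: open_ruled_domain. Qed.

(* The singular points of the ruled map are those whose last coordinate is this
   function of the others. *)
Definition striction (y : 'rV[R]_p.+1) : R :=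
  - (mu (tcoord y) + \sum_(l < p) ucoord y l * lam (wid l) (tcoord y)).

(** The ruled map restricted to the graph of [striction], where the coefficient
    [mu + \sum_l u_l * lam_l + u_max] of [e] in the t-derivative vanishes. *)
Definition singular_locus (y : 'rV[R]_p.+1) : 'rV[R]_N :=
  ruled_map g (fun l => X (wid l)) y + striction y *: X ord_max (tcoord y).

Let c := striction.
Let xi := singular_locus.
Let Xm (y : 'rV[R]_p.+1) := X ord_max (tcoord y).

(* The functional [dotv _ (covector t)] on the span of the [X j t] vanishes on the
   directions of the singular locus inside the ruling. *)
Definition covector (t : R) : 'rV[R]_N := \sum_j lam j t *: X j t.

(** The u-derivatives of the locus span the hyperplane of the ruling killed by the covector, and its
    t-derivative lies in the ruling. This number therefore vanishes exactly when the t-derivative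
    adds nothing to the rank. *)
Definition tangency_defect (y : 'rV[R]_p.+1) : R :=
  dotv (derive xi y (ev R ord0)) (covector (tcoord y)).

Let delta := tangency_defect.

Lemma smooth_ucoord (l : 'I_p) : smooth_on Om (fun y => ucoord y l).
Proof. exact: smooth_row_coord (lift ord0 l) oOm. Qed.

Lemma smooth_striction : smooth_on Om c.
Proof.
have S l := smooth_mul oOm (smooth_ucoord l) (smooth_tcoord (@slam (wid l))).
have S1 := @smooth_sum _ _ _ oOm _ _ (index_enum 'I_p) xpredT _ (fun l _ => S l).
exact: (smooth_opp oOm (smooth_add oOm (smooth_tcoord smu) S1)).
Qed.

Lemma smooth_Xm : smooth_on Om Xm.
Proof. exact: smooth_tcoord (@sX ord_max). Qed.

Lemma smooth_singular_locus : smooth_on Om xi.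
Proof.
have S l := smooth_scale oOm (smooth_ucoord l) (smooth_tcoord (@sX (wid l))).
have S1 := @smooth_sum _ _ _ oOm _ _ (index_enum 'I_p) xpredT _ (fun l _ => S l).
have S2 := smooth_add oOm (smooth_tcoord sg) S1.
exact: (smooth_add oOm S2 (smooth_scale oOm smooth_striction smooth_Xm)).
Qed.

Lemma smooth_covector : smooth_on J covector.
Proof.
exact: (@smooth_sum _ _ _ oJ _ _ (index_enum 'I_p.+1) xpredT _
  (fun j _ => smooth_scale oJ (@slam j) (@sX j))).
Qed.

Lemma smooth_tangency_defect : smooth_on Om delta.
Proof.
exact: (smooth_dotv oOm (smooth_derive (ev R ord0) smooth_singular_locus)
  (smooth_tcoord smooth_covector)).
Qed.

Lemma dotv_suml n (F : 'I_n -> 'rV[R]_N) w : dotv (\sum_i F i) w = \sum_i dotv (F i) w.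
Proof. by rewrite /dotv mulmx_suml summxE. Qed.

Lemma dotv_covector t j : J t -> dotv (X j t) (covector t) = lam j t.
Proof.
move=> Jt; rewrite dotvC dotv_suml (bigD1 j) //= big1 ?addr0 => [|i ij].
  by rewrite dotvZl oX // eqxx mulr1.
by rewrite dotvZl oX // (negbTE ij) mulr0.
Qed.

Let is_derive_xi y v : Om y ->
  is_derive y v xi (tcoord v *: ruled_map (fun t => derive g t 1)
      (fun l t => derive (X (wid l)) t 1) y +
    \sum_(l < p) ucoord v l *: X (wid l) (tcoord y) +
    (c y *: (tcoord v *: derive (X ord_max) (tcoord y) 1) + derive c y v *: Xm y)).
Proof.
move=> Jy.
have dg : derivable g (tcoord y) 1 := smooth_derivable sg Jy.
have dX j : derivable (X j) (tcoord y) 1 := smooth_derivable (@sX j) Jy.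
have dc : is_derive y v c (derive c y v).
  by apply: derivableP; exact: smooth_derivable smooth_striction Jy.
exact: (is_deriveD (is_derive_ruled v dg (fun l => dX (wid l)))
  (is_derive_scale dc (is_derive_tcoord v (dX ord_max)))).
Qed.

Lemma derive_striction y l : Om y ->
  derive c y (ev R (lift ord0 l)) = - lam (wid l) (tcoord y).
Proof.
move=> Jy; set v := ev R _.
have dmu : derivable mu (tcoord y) 1 := smooth_derivable smu Jy.
have dlam j : derivable (lam j) (tcoord y) 1 := smooth_derivable (@slam j) Jy.
have D := is_deriveN (is_deriveD (is_derive_tcoord v dmu) (is_derive_sum (fun l =>
  is_deriveM (is_derive_coord (lift ord0 l) y v) (is_derive_tcoord v (dlam (wid l)))))).
have cE : - ((fun y => mu (tcoord y)) + \sum_(l < p)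
    ((fun y : 'rV[R]_p.+1 => y 0 (lift ord0 l)) * (fun y => lam (wid l) (tcoord y)))) = c.
  by apply/funext => z; rewrite /c /striction /= fct_sumE.
rewrite cE in D; rewrite (@derive_val _ _ _ _ _ _ _ D).
rewrite tcoord_ev_lift scale0r add0r; congr (- _).
under eq_bigr => i _.
  rewrite scale0r scaler0 add0r -[v 0 _]/(ucoord v i) ucoord_ev_lift.
  rewrite [_ *: _]mulrC; over.
exact: (sum_delta l (fun i => lam (wid i) (tcoord y))).
Qed.

Lemma derive_singular_locus_u y l : Om y ->
  derive xi y (ev R (lift ord0 l)) = X (wid l) (tcoord y) - lam (wid l) (tcoord y) *: Xm y.
Proof.
move=> Jy; rewrite (@derive_val _ _ _ _ _ _ _ (is_derive_xi _ Jy)).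
rewrite tcoord_ev_lift !scale0r scaler0 !add0r derive_striction// scaleNr.
congr (_ - _); under eq_bigr do rewrite ucoord_ev_lift.
exact: (sum_delta l (fun i => X (wid i) (tcoord y))).
Qed.

(** Modulo the ruling, the terms of the t-derivative add up to [mu + \sum_l u_l * lam_l + c] times
    [e], and [striction] is chosen to make this coefficient zero. *)
Lemma derive_singular_locus_t y : Om y ->
  (derive xi y (ev R ord0) <= frame X (tcoord y))%MS.
Proof.
move=> Jy; rewrite (@derive_val _ _ _ _ _ _ _ (is_derive_xi _ Jy)).
rewrite tcoord_ev0 !scale1r [X in _ + X + _]big1; last first.
  by move=> l _; rewrite ucoord_ev0 scale0r.
set t := tcoord y; rewrite addr0 addrA.
apply: addmx_sub; last by apply: scalemx_sub; exact: frame_sub.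
set w := (X in (X <= _)%MS).
have -> : w = (derive g t 1 - mu t *: e t) +
    \sum_(l < p) ucoord y l *: (derive (X (wid l)) t 1 - lam (wid l) t *: e t) +
    c y *: (derive (X ord_max) t 1 - lam ord_max t *: e t).
  rewrite lam_max // scale1r /w /ruled_map -/t.
  under [in RHS]eq_bigr do rewrite scalerBr scalerA.
  have ce : c y *: e t = - (mu t *: e t + (\sum_(l < p) ucoord y l * lam (wid l) t) *: e t).
    by rewrite /c /striction scaleNr scalerDl.
  rewrite sumrB -scaler_suml scalerBr ce opprK [X in _ = X + _]addrACA -opprD.
  by rewrite [RHS]addrACA addNr addr0.
apply: addmx_sub; last by apply: scalemx_sub; exact: X_e.
apply: addmx_sub; first exact: g_e.
by apply: summx_sub => l _; apply: scalemx_sub; exact: X_e.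
Qed.

Lemma jac_singular_locus y : Om y -> (jac xi y <= frame X (tcoord y))%MS.
Proof.
move=> Jy; apply/row_subP => i; rewrite rowK.
case: (unliftP ord0 i) => [l ->|->]; last exact: derive_singular_locus_t.
rewrite derive_singular_locus_u//; apply: addmx_sub; first exact: frame_sub.
by rewrite -scaleNr; apply: scalemx_sub; exact: frame_sub.
Qed.

Let dotv_row_u y l l' : Om y ->
  dotv (derive xi y (ev R (lift ord0 l))) (X (wid l') (tcoord y)) = (l == l')%:R.
Proof.
move=> Jy; rewrite derive_singular_locus_u// -scaleNr dotvDl dotvZl !oX//.
(* The index [ord_max] has value [p], which exceeds that of [wid l'], so the term with [X ord_max]
   drops out. *)
rewrite -!val_eqE /= [p == _]gtn_eqF ?ltn_ord// mulr0 addr0.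
by [].
Qed.

Let dotv_covector_u y l : Om y ->
  dotv (derive xi y (ev R (lift ord0 l))) (covector (tcoord y)) = 0.
Proof.
move=> Jy; rewrite derive_singular_locus_u// -scaleNr dotvDl dotvZl !dotv_covector//.
by rewrite lam_max// mulr1 subrr.
Qed.

Let dotv_sum_u y (a : 'I_p -> R) l : Om y ->
  dotv (\sum_i a i *: derive xi y (ev R (lift ord0 i))) (X (wid l) (tcoord y)) = a l.
Proof.
move=> Jy; rewrite dotv_suml; transitivity (\sum_i (i == l)%:R *: a i).
  by apply: eq_bigr => i _; rewrite dotvZl (dotv_row_u i l Jy) [LHS]mulrC.
exact: (sum_delta l a).
Qed.

Let dotv_jac y (a : 'rV_p.+1) : Om y ->
  dotv (a *m jac xi y) (covector (tcoord y)) = a 0 ord0 * delta y.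
Proof.
move=> Jy; rewrite mul_jac big_ord_recl dotvDl dotvZl dotv_suml big1 ?addr0// => l _.
by rewrite dotvZl dotv_covector_u// mulr0.
Qed.

Let MM y : Om y -> frame X (tcoord y) *m (frame X (tcoord y))^T = 1%:M.
Proof. by move=> Jy; exact: frame_orthonormal (oX Jy). Qed.

(** Pairing a linear relation with the covector kills its u-terms and, as the defect is nonzero,
    forces the t-coefficient to vanish. Pairing with each [X (wid l)] then reads off the other
    coefficients. *)
Lemma singular_locus_regular y : Om y -> delta y != 0 -> regular_at xi y.
Proof.
move=> Jy d0; apply: row_free_ker => a a0.
have a00 : a 0 ord0 = 0.
  have := dotv_jac a Jy; rewrite a0 /dotv mul0mx mxE => /esym/eqP.
  by rewrite mulf_eq0 (negbTE d0) orbF => /eqP.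
apply/rowP => i; rewrite [RHS]mxE; case: (unliftP ord0 i) => [l ->|-> //].
move: a0; rewrite mul_jac big_ord_recl a00 scale0r add0r => a0.
rewrite -(dotv_sum_u (fun l => a 0 (lift ord0 l)) l Jy) a0.
by rewrite /dotv mul0mx mxE.
Qed.

(** With zero defect the covector annihilates the whole tangent space of the locus, yet it takes the
    value [lam ord_max = 1] on [X ord_max]. *)
Lemma singular_locus_transverse y : Om y -> delta y = 0 -> ~~ (Xm y <= jac xi y)%MS.
Proof.
move=> Jy d0; apply/negP => /submxP[a aE].
have := dotv_jac a Jy; rewrite -aE d0 mulr0 dotv_covector// lam_max// => /eqP.
by rewrite oner_eq0.
Qed.

(** Full rank would make the tangent space the whole ruling, which contains [X ord_max], against
    transversality. The [p] derivatives along [u] are independent, which gives the lower bound. *)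
Lemma singular_locus_rank y : Om y -> delta y = 0 -> \rank (jac xi y) = p.
Proof.
move=> Jy d0; apply/eqP; rewrite eqn_leq; apply/andP; split.
  have nf : ~~ row_free (jac xi y).
    apply: contra (singular_locus_transverse Jy d0) => /eqP rj.
    apply: submx_trans (frame_sub X (tcoord y) ord_max) _.
    have [_ <-] := mxrank_leqif_sup (jac_singular_locus Jy).
    by rewrite rj eq_sym; exact: orthonormal_row_free (MM Jy).
  by rewrite -ltnS ltn_neqAle rank_leq_row andbT.
pose D := \matrix_(l < p) derive xi y (ev R (lift ord0 l)).
have fD : row_free D.
  apply: row_free_ker => a; rewrite mulmx_sum_row => a0; apply/rowP => l.
  rewrite mxE -(dotv_sum_u (fun i => a 0 i) l Jy).
  under eq_bigr do rewrite -(rowK (fun i => derive xi y (ev R (lift ord0 i)))).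
  by rewrite a0 /dotv mul0mx mxE.
apply: leq_trans (_ : \rank D <= _)%N; first by rewrite (eqP fD).
apply: mxrankS; apply/row_subP => l.
by rewrite rowK -[X in (X <= _)%MS](rowK (fun i => derive xi y (ev R i))) row_sub.
Qed.

(** These are [p.+2] rows inside the ruling, whose dimension is at most [p.+1]. *)
Lemma singular_locus_tangent y : Om y -> ~~ row_free (col_mx (jac xi y) (Xm y)).
Proof.
move=> Jy; have : (\rank (col_mx (jac xi y) (Xm y)) <= p.+1)%N.
  apply: leq_trans (rank_leq_row (frame X (tcoord y))); apply: mxrankS.
  by rewrite col_mx_sub jac_singular_locus// frame_sub.
by apply: contraL => /eqP ->; rewrite addn1 ltnn.
Qed.

Let f := ruled_map g X.

(** The last coordinate is measured from the singular locus along its ruling line. *)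
Lemma ruled_map_shear x :
  f x = cone_map xi Xm (x + (- c (initc x)) *: ev R ord_max).
Proof.
rewrite /cone_map initc_shear lastc_shear scalerDl scaleNr /xi /singular_locus.
rewrite -/c -/(Xm _) addrACA subrr addr0 /f /ruled_map big_ord_recr /=.
rewrite ucoord_max tcoord_initc addrA /Xm tcoord_initc; congr (_ + _ + _).
by apply: eq_bigr => l _; rewrite ucoord_initc.
Qed.

(** The factor [s] lets one formula give the change of parameters, at -1, and its inverse, at 1:
    [initc], on which the shift depends, is left unchanged. *)
Let shear (s : R) (x : 'rV[R]_p.+2) := x + (s * c (initc x)) *: ev R ord_max.

Let smooth_shear U s : open U -> U `<=` Om -> smooth_on (@initc R p.+1 @^-1` U) (shear s).
Proof.
move=> oU UOm; have oV : open (@initc R p.+1 @^-1` U).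
  by apply: open_comp => // x _; exact: initc_continuous.
have sc : smooth_on (@initc R p.+1 @^-1` U) (fun x => c (initc x)).
  apply: (smooth_comp_linear initc_linear initc_continuous _ smooth_striction).
  by move=> x Ux; exact: UOm.
apply/(smooth_coordP oV) => i.
have cst (a : R) := @smooth_cst _ _ (@initc R p.+1 @^-1` U) _ a.
have S := smooth_add oV (smooth_row_coord i oV)
  (smooth_mul oV (smooth_mul oV (cst s) sc) (cst (ev R ord_max 0 i))).
by apply: (smooth_ext oV _ S) => x _; rewrite [RHS]mxE; congr (_ + _); rewrite [RHS]mxE.
Qed.

Lemma ruled_local_model (D : set 'rV[R]_p.+2) U x : open U -> U `<=` Om -> U (initc x) ->
  @initc R p.+1 @^-1` U `<=` D ->
  (forall y, U y -> delta y != 0) \/ (forall y, U y -> delta y = 0) ->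
  local_model D f x.
Proof.
move=> oU UOm Ux UD dU; set V := @initc R p.+1 @^-1` U.
have oV : open V by apply: open_comp => // z _; exact: initc_continuous.
have shearK s z : shear (- s) (shear s z) = z.
  by rewrite /shear initc_shear -addrA -scalerDl -mulrDl subrr mul0r scale0r addr0.
have sxi : smooth_on U xi by move=> vs y Uy; apply: smooth_singular_locus; exact: UOm.
have sXm : smooth_on U Xm by move=> vs y Uy; apply: smooth_Xm; exact: UOm.
have uX y : U y -> dotv (Xm y) (Xm y) = 1.
  by move=> Uy; rewrite oX ?eqxx//; exact: UOm.
exists V, V, (shear (-1)), (cone_map xi Xm).
split=> //; split=> //; split; last split.
- split=> //; split=> //; split; first exact: smooth_shear.
  exists (shear 1); split; first exact: smooth_shear.
  split=> y Vy; split.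
  + by rewrite /V /= /shear initc_shear.
  + by have := shearK (-1) y; rewrite opprK.
  + by rewrite /V /= /shear initc_shear.
  + exact: shearK.
- by move=> y _; rewrite ruled_map_shear /shear mulN1r.
right; case: dU => [d0|d0]; [right|left].
  exists U, xi, Xm; do 3!split=> //.
  split; first by move=> y Uy; apply: singular_locus_regular; [exact: UOm|exact: d0].
  split=> //; split; first by move=> y Uy; apply: singular_locus_tangent; exact: UOm.
  by split.
exists U, xi, Xm; do 3!split=> //.
split; first by move=> y Uy; apply: singular_locus_rank; [exact: UOm|exact: d0].
split=> //; split; last by split.
by move=> y Uy; apply: singular_locus_transverse; [exact: UOm|exact: d0].
Qed.

(** Let [E] be the slice of [O] through [x] with fixed last coordinate. If the defect is nonzero at
    some point of [E] over [J], it stays nonzero near it, and a tangent model exists at a point of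
    [O]. Otherwise it vanishes on a neighborhood of [initc x], and [x] itself has a cone model. *)
Lemma ruled_local_model_near (I : set R) x O : J `<=` I -> J (tcoord x) -> nbhs x O ->
  exists2 y, O y & local_model (ruled_domain p.+1 I) f y.
Proof.
move=> JI Jx xO; pose E := extend (lastc x) @^-1` O.
have xE : nbhs (initc x) E.
  by apply: extend_continuous; rewrite extend_initc.
have Omx : Om (initc x) by rewrite /Om /ruled_domain /= tcoord_initc.
have OmI U : U `<=` Om -> @initc R p.+1 @^-1` U `<=` ruled_domain p.+1 I.
  by move=> UOm z /UOm; rewrite /Om /ruled_domain /= tcoord_initc => /JI.
case: (pselect (exists y, [/\ E y, Om y & delta y != 0])) => [[y [Ey Oy d0]]|nE].
  exists (extend (lastc x) y) => //.
  pose U := [set z | Om z /\ delta z != 0].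
  have UOm : U `<=` Om by move=> z [].
  apply: (@ruled_local_model _ U) => //; [|by rewrite initc_extend|exact: OmI|].
    rewrite openE => z [Oz dz]; have cd := smooth_continuous smooth_tangency_defect Oz.
    apply: filterI; first exact: open_nbhs_nbhs.
    exact: (cvgr_neq0 (delta z) cd dz).
  by left=> z [].
exists x; first exact: nbhs_singleton.
pose U := (E `&` Om)°.
have UOm : U `<=` Om by move=> z /interior_subset [].
apply: (@ruled_local_model _ U) => //; [exact: open_interior| |exact: OmI|].
  by rewrite /U /interior; apply: filterI => //; exact: open_nbhs_nbhs.
right=> y /interior_subset [Ey Oy]; apply: contrapT => /eqP d0.
by apply: nE; exists y.
Qed.

End ConeTangent.

(** * Density of the local models *)

Section CoordinatePermutation.
Variables (R : realType) (k N : nat).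

Lemma col_perm_continuous (s : 'S_k.+1) :
  continuous (col_perm s : 'rV[R]_k.+1 -> 'rV[R]_k.+1).
Proof.
move=> y; apply: continuous_rV => i.
rewrite (_ : (fun z => _) = (fun z : 'rV[R]_k.+1 => z 0 (s i))).
  exact: coord_continuous.
by apply/funext => z; rewrite mxE.
Qed.

(** The permutation is its own inverse, so composing it with the chart for [h] gives a chart for [f]
    with the same model. *)
Lemma permuted_local_model (D : set 'rV[R]_k.+1) (f h : 'rV[R]_k.+1 -> 'rV[R]_N)
    (s : 'S_k.+1) x :
  (s * s = 1)%g -> (forall y, D y -> D (col_perm s y)) ->
  (forall y, f y = h (col_perm s y)) ->
  local_model D h (col_perm s x) -> local_model D f x.
Proof.
move=> ss sD fh [V [V' [phi [F [Vx [VD [[oV [oV' [sphi [psi [spsi [phiK psiK]]]]]] [FE mod]]]]]]]].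
pose P : 'rV[R]_k.+1 -> 'rV[R]_k.+1 := col_perm s.
have PK y : P (P y) = y by rewrite /P -col_permM ss col_perm1.
have linP : linear P by move=> a u v; apply/rowP => i; rewrite !mxE.
have contP : continuous P by exact: col_perm_continuous.
exists (P @^-1` V), V', (phi \o P), F; split; first exact: Vx.
split; first by move=> y /VD/sD; rewrite -/(P _) -/(P _) PK.
split; last by split=> // y Vy; rewrite fh; exact: FE.
split; first by apply: open_comp => // z _; exact: contP.
split=> //; split; first exact: (smooth_comp_linear linP contP _ sphi).
exists (P \o psi); split.
  apply/(smooth_coordP oV') => i; move/(smooth_coordP oV')/(_ (s i)): spsi.
  by apply: (smooth_ext oV') => y _; rewrite /= /P [RHS]mxE.
split=> y Vy; first by have [? e] := phiK _ Vy; split=> //=; rewrite e PK.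
by have [? e] := psiK _ Vy; rewrite /= PK.
Qed.

End CoordinatePermutation.

(** * Points near which the ruling does not turn *)

Section Flat.
Variables (R : realType) (k N : nat) (I : set R).
Variables (g : R -> 'rV[R]_N) (X : 'I_k -> R -> 'rV[R]_N).
Hypothesis data : ruled_data I g X.
Let oI : open I. Proof. exact: data.1.1.1. Qed.
Let sX j : smooth_on I (X j). Proof. exact: (data.2.1 j). Qed.
Let oX t : I t -> forall i j, dotv (X i t) (X j t) = (i == j)%:R.
Proof. exact: (data.2.2 t). Qed.
Let MM t : I t -> frame X t *m (frame X t)^T = 1%:M.
Proof. by move=> It; exact: frame_orthonormal (oX It). Qed.
Let X' j t := derive (X j) t 1.
Let nrm t := normal_part (frame X t).
Let D := ruled_domain k I.
Let f := ruled_map g X.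

Lemma join_continuous (u : 'rV[R]_k) : continuous (fun t : R => join t u).
Proof.
move=> t; apply: continuous_rV => i; case: (unliftP ord0 i) => [j ->|->].
  rewrite (_ : (fun _ => _) = (fun=> u 0 j)); first exact: cst_continuous.
  by apply/funext => s; rewrite join_lift.
rewrite (_ : (fun _ => _) = id); first exact: cvg_id.
by apply/funext => s; rewrite mxE unlift_none.
Qed.

Lemma flat_local_model x O : D x -> nbhs x O ->
  (forall y, O y -> D y -> forall j, nrm (tcoord y) (X' j (tcoord y)) = 0) ->
  local_model D f x.
Proof.
move=> Dx xO flat.
(* The flatness condition at [y] depends on [tcoord y] only, so it is enough to follow [O] along the
   line of fixed [upart x]. A ball in this neighborhood of [tcoord x] is the interval required for a
   cylinder. *)
have : nbhs (tcoord x) [set t | O (join t (upart x)) /\ I t].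
  apply: filterI; last exact: open_nbhs_nbhs.
  by apply: join_continuous; rewrite join_parts.
move=> /nbhs_ballP[r /= r0 rO]; pose J := ball (tcoord x) r.
have JI : J `<=` I by move=> t /rO[].
have oJ : open J by exact: ball_open.
have iJ : is_interval J.
  move=> a b; rewrite /J /ball /= !ltr_distlC => /andP[a1 a2] /andP[b1 b2] z /andP[az zb].
  by rewrite /= ltr_distlC (lt_le_trans a1 az) (le_lt_trans zb b2).
apply: (cylinder_local_model oJ iJ _ _ _ data.1 JI).
- by move=> j t i Jt; apply: sX; exact: JI.
- by move=> t Jt; apply: oX; exact: JI.
- move=> t Jt j; have It := JI _ Jt; rewrite -(normal_part_eq0 (MM It)).
  have [Ot _] := rO _ Jt; apply/eqP.
  by have := flat _ Ot; rewrite /D /ruled_domain /= tcoord_join => /(_ It j).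
exact: ballxx.
Qed.

Lemma smooth_normal_derivative j : smooth_on I (fun t => nrm t (X' j t)).
Proof.
have sX' : smooth_on I (X' j) := smooth_derive (1 : R) (@sX j).
have S := @smooth_sum _ _ _ oI _ _ (index_enum 'I_k) xpredT _
  (fun l _ => smooth_scale oI (smooth_dotv oI sX' (@sX l)) (@sX l)).
have S1 := smooth_add oI sX' (smooth_scale oI (@smooth_cst _ _ I _ (-1 : R)) S).
apply: (smooth_ext oI _ S1) => t _.
rewrite /nrm /normal_part scaleN1r mul_frame; congr (_ - _).
apply: eq_bigr => l _; rewrite /dotv !mxE; congr (_ *: _).
by apply: eq_bigr => i _; rewrite !mxE.
Qed.

End Flat.

(** * Points at which the ruling turns *)

Section Curved.
Variables (R : realType) (p N : nat) (I : set R).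
Variables (g : R -> 'rV[R]_N) (X : 'I_p.+1 -> R -> 'rV[R]_N).

Lemma curved_local_model x O : ruled_data I g X ->
  (forall t, I t -> normal_part (frame X t) (derive (X ord_max) t 1) != 0 ->
    (forall j, exists c, normal_part (frame X t) (derive (X j) t 1) =
       c *: normal_part (frame X t) (derive (X ord_max) t 1)) /\
    exists c, normal_part (frame X t) (derive g t 1) =
       c *: normal_part (frame X t) (derive (X ord_max) t 1)) ->
  I (tcoord x) -> nbhs x O ->
  normal_part (frame X (tcoord x)) (derive (X ord_max) (tcoord x) 1) != 0 ->
  exists2 y, O y & local_model (ruled_domain p.+1 I) (ruled_map g X) y.
Proof.
move=> data col Ix xO ex0.
pose nrm t := normal_part (frame X t).
pose e t := nrm t (derive (X ord_max) t 1).
pose q t := dotv (e t) (e t).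
have oI : open I := data.1.1.1.
have sg : smooth_on I g := data.1.2.1.
have sX j : smooth_on I (X j) := data.2.1 j.
have oX t : I t -> forall i j, dotv (X i t) (X j t) = (i == j)%:R := data.2.2 t.
have MM t : I t -> frame X t *m (frame X t)^T = 1%:M.
  by move=> It; exact: frame_orthonormal (oX _ It).
have se : smooth_on I e by exact: (smooth_normal_derivative data ord_max).
have sq : smooth_on I q := smooth_dotv oI se se.
pose J := [set t | I t /\ q t != 0].
have JI : J `<=` I by move=> t [].
have oJ : open J.
  rewrite openE => t [It qt]; have cq := smooth_continuous sq It.
  apply: filterI; first exact: open_nbhs_nbhs.
  exact: (cvgr_neq0 (q t) cq qt).
have sub (W : normedModType R) (h : R -> W) : smooth_on I h -> smooth_on J h.
  by move=> sh vs t Jt; apply: sh; exact: JI.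
(* If the normal part of [w] is [c *: e], then [c] is the quotient of [dotv w e] by [dotv e e],
   because [e] is itself normal. This formula shows that the pointwise coefficients of the
   collinearity hypothesis are smooth on [J], where [e] is nonzero. *)
pose coef (w : R -> 'rV[R]_N) t := dotv (w t) (e t) * (q t)^-1.
have scoef w : smooth_on I w -> smooth_on J (coef w).
  move=> sw; apply: (smooth_mul oJ).
    by apply: sub; exact: (smooth_dotv oI sw se).
  by apply: (smooth_inv oJ); [move=> t []|exact: sub].
have coefE t (w : R -> 'rV[R]_N) : J t -> (exists c, nrm t (w t) = c *: e t) ->
    (w t - coef w t *: e t <= frame X t)%MS.
  move=> [It qt] [b wE]; have -> : coef w t = b.
    by rewrite /coef -(dotv_normal_part (MM _ It)) -/(nrm t _) wE dotvZl mulfK.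
  by rewrite -wE /nrm /normal_part opprB addrCA subrr addr0 submxMl.
have e0 t : J t -> e t != 0 by move=> [_]; rewrite dotv_eq0.
apply: (@ruled_local_model_near R p N J g X (coef (fun t => derive g t 1))
  (fun j => coef (fun t => derive (X j) t 1)) e oJ) => //.
- exact: (sub _ _ sg).
- by move=> j; exact: (sub _ _ (sX j)).
- by apply: scoef; exact: (smooth_derive (1 : R) sg).
- by move=> j; apply: scoef; exact: (smooth_derive (1 : R) (sX j)).
- by move=> t /JI; exact: oX.
- by move=> t Jt; apply: (coefE t _ Jt); exact: (col t (JI _ Jt) (e0 _ Jt)).2.
- by move=> t Jt j; apply: (coefE t _ Jt); exact: (col t (JI _ Jt) (e0 _ Jt)).1.
- move=> t [It qt]; rewrite /coef -(dotv_normal_part (MM _ It)).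
  by rewrite -/(nrm t _) -/(e t) mulfV.
- have q0 : q (tcoord x) != 0 by rewrite /q dotv_eq0.
  exact: (conj Ix q0).
exact: xO.
Qed.

End Curved.

Lemma curved_ruled_local_model (R : realType) (k N : nat) (I : set R)
    (g : R -> 'rV[R]_N) (X : 'I_k -> R -> 'rV[R]_N) (j0 : 'I_k) x O :
  ruled_data I g X -> rank_one (ruled_domain k I) (ruled_map g X) ->
  O x -> open O -> I (tcoord x) ->
  normal_part (frame X (tcoord x)) (derive (X j0) (tcoord x) 1) != 0 ->
  exists2 y, O y & local_model (ruled_domain k I) (ruled_map g X) y.
Proof.
case: k X j0 x O => [|p] X j0 x O; first by case: j0.
move=> data r1 Ox oO Ix ne0.
(* Exchange [j0] with the last index: [s] acts on the ruling vectors, and [S] acts accordingly on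
   the parameters, fixing the t-coordinate. *)
pose s : 'S_p.+1 := tperm j0 ord_max.
pose S : 'S_p.+2 := tperm (lift ord0 j0) (lift ord0 ord_max).
have SE j : S (lift ord0 j) = lift ord0 (s j) by rewrite /S /s (inj_tperm _ _ _ (@lift_inj _ ord0)).
have SS : (S * S = 1)%g by exact: tperm2.
have ss j : s (s j) = j by exact: tpermK.
pose Y j := X (s j).
have tS (y : 'rV[R]_p.+2) : tcoord (col_perm S y) = tcoord y.
  by rewrite /tcoord mxE tpermD.
have fY y : ruled_map g X y = ruled_map g Y (col_perm S y).
  rewrite /ruled_map tS (reindex_inj (@perm_inj _ s)); congr (_ + _).
  by apply: eq_bigr => j _; rewrite /ucoord mxE SE.
(* Reordering the frame leaves its span, and so the projection, unchanged. *)
have nE t w : normal_part (frame Y t) w = normal_part (frame X t) w.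
  rewrite /normal_part !mul_frame; congr (_ - _).
  rewrite [RHS](reindex_inj (@perm_inj _ s)); apply: eq_bigr => j _.
  by congr (_ *: _); rewrite !mxE; apply: eq_bigr => i _; rewrite !mxE.
have dataY : ruled_data I g Y.
  split; first exact: data.1; split; first by move=> j; exact: data.2.1.
  by move=> t It i j; rewrite (data.2.2 t It) (inj_eq perm_inj).
have Ymax : Y ord_max = X j0 by rewrite /Y /s tpermR.
have colY t : I t -> normal_part (frame Y t) (derive (Y ord_max) t 1) != 0 ->
    (forall j, exists c, normal_part (frame Y t) (derive (Y j) t 1) =
       c *: normal_part (frame Y t) (derive (Y ord_max) t 1)) /\
    exists c, normal_part (frame Y t) (derive g t 1) =
       c *: normal_part (frame Y t) (derive (Y ord_max) t 1).
  move=> It; rewrite !nE Ymax => /(normal_parts_collinear data r1 It)[cX cg].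
  by split=> [j|]; [have [b bE] := cX (s j)|have [b bE] := cg]; exists b; rewrite ?nE.
pose P : 'rV[R]_p.+2 -> 'rV[R]_p.+2 := col_perm S.
have PK y : P (P y) = y by rewrite /P -col_permM SS col_perm1.
have cP : continuous P by exact: col_perm_continuous.
have [|||y Oy ly] := @curved_local_model R p N I g Y (P x) (P @^-1` O) dataY colY.
- by rewrite tS.
- by apply: cP; rewrite PK; exact: open_nbhs_nbhs.
- by rewrite tS nE Ymax.
exists (P y) => //; apply: (permuted_local_model SS _ fY).
  by move=> z; rewrite /ruled_domain /= tS.
by rewrite -/(P _) PK.
Qed.

Unset Implicit Arguments.
Set Strict Implicit.

(* m = k.+1, ambient dimension m + n = k.+1 + n *)
Theorem theorem1p2 (R : realType) (k n : nat) (I : set R)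
  (g : R -> 'rV[R]_(k.+1 + n)) (X : 'I_k -> R -> 'rV[R]_(k.+1 + n)) :
  ruled_data I g X ->
  rank_one (ruled_domain k I) (ruled_map g X) ->
  exists W : set 'rV[R]_k.+1,
    open W /\ W `<=` ruled_domain k I /\ ruled_domain k I `<=` closure W /\
    forall x, W x ->
      exists (V V' : set 'rV[R]_k.+1) (phi : 'rV[R]_k.+1 -> 'rV[R]_k.+1)
             (F : 'rV[R]_k.+1 -> 'rV[R]_(k.+1 + n)),
        V x /\ V `<=` W /\ diffeo V V' phi /\
        (forall y, V y -> ruled_map g X y = F (phi y)) /\
        (cylinder_model V' F \/ cone_model V' F \/ tangent_model V' F).
Proof.
move=> data r1; apply: local_models_dense => x O Dx xO.
pose q j t := normal_part (frame X t) (derive (X j) t 1).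
(* By density it is enough to find one point of [O] with a local model. Either the ruling turns at
   some point over [I] in the interior of [O], or it turns at none and [x] itself lies on a
   cylinder; for [k = 0] the second case holds vacuously. *)
have [[y [j0 [Oy Dy qy]]]|flat] :=
    pselect (exists y j, [/\ O° y, I (tcoord y) & q j (tcoord y) != 0]).
  have [z Oz lz] := curved_ruled_local_model data r1 Oy (@open_interior _ O) Dy qy.
  by exists z => //; exact: interior_subset Oz.
exists x; first exact: nbhs_singleton.
apply: (flat_local_model data Dx (nbhs_interior xO)) => y Oy Dy j.
by apply: contrapT => /eqP qy; apply: flat; exists y, j.
Qed.
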